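(* Let $\mathcal R$ be a finite subdivision rule whose subdivision map is a Thurston map. Then the fat path subdivision graph $\Gamma$ of $\mathcal R$ is Gromov hyperbolic if and only if there exist positive integers $M$ and $n$ with the following property: whenever $m$ is a nonnegative integer, $u$ and $v$ are vertices of $\Gamma_m$ with $\delta_m(u,v)\ge M$, and $u'$ and $v'$ are vertices of $\Gamma_{m+n}$ such that $f_{m,m+n}(u')=u$ and $f_{m,m+n}(v')=v$, then $\delta_{m+n}(u',v')>\delta_m(u,v)$.
   Context: A branched covering $f\colon S^2\to S^2$ is an orientation-preserving continuous map such that for each $x$ there are local charts about $x$ and $f(x)$ (sending them to $0$) in which $f$ is $z\mapsto z^{\deg_x(f)}$ for a positive integer $\deg_x(f)$. Let $P_f=\bigcup_{k>0}f^k(\{x:\deg_x(f)>1\})$. $f$ is a Thurston map if $P_f$ is finite. A finite subdivision rule $\mathcal R$ consists of a finite 2-dimensional CW complex $S_{\mathcal R}$ which is the union of its closed 2-cells, a subdivision $\mathcal R(S_{\mathcal R})$ of $S_{\mathcal R}$, and a continuous cellular map $f\colon\mathcal R(S_{\mathcal R})\to S_{\mathcal R}$ (the subdivision map) whose restriction to each open cell is a homeomorphism onto an open cell. Moreover, for each closed 2-cell $\tilde t$ of $S_{\mathcal R}$ there are a cell structure $t$ on the 2-disk (the tile type of $\tilde t$) whose 1-skeleton is the boundary circle and which has at least three vertices, and a continuous surjection $\psi_t\colon t\to\tilde t$ whose restriction to each open cell is a homeomorphism. Throughout, $S_{\mathcal R}$ is homeomorphic to $S^2$ and $f$ is orientation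 preserving, so $f$ is a Thurston map. Pulling back cell structures gives successive refinements $\mathcal R^0(S^2)=S_{\mathcal R},\mathcal R^1(S^2),\ldots$ such that $f$ maps each open cell of $\mathcal R^k(S^2)$ homeomorphically onto an open cell of $\mathcal R^{k-1}(S^2)$. Tiles are closed 2-cells. Let $\mathcal R^{-1}(S^2)$ be a cell structure on $S^2$ with a single tile, namely all of $S^2$, obtained from a tree in the 1-skeleton of $\mathcal R^0(S^2)$ containing $P_f$ all of whose leaves lie in $P_f$. The fat path subdivision graph $\Gamma$ of $\mathcal R$ has a vertex $v(t)$ for every tile $t$ of $\mathcal R^k(S^2)$, $k\ge -1$. For each tile $t$ of $\mathcal R^k(S^2)$, $v(t)$ is joined by a (vertical) edge to $v(s)$ for every tile $s\subseteq t$ of $\mathcal R^{k+1}(S^2)$, and by a (horizontal) edge to $v(s)$ for every tile $s\ne t$ of $\mathcal R^k(S^2)$ having an edge in common with $t$. Every edge has length 1. $\Gamma_k$ is the subgraph spanned by the vertices of tiles of $\mathcal R^k(S^2)$, with path metric $\delta_k$ (possibly taking the value $\infty$). For $-1\le m\le k$ the transition function $f_{m,k}\colon\Gamma_k\to\Gamma_m$ sends $v(t)$ to $v(s)$, where $s$ is the tile of $\mathcal R^m(S^2)$ containing $t$ (extended to edges in the obvious way). *)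

(* Defs.v *)
From HB Require Import structures.
From mathcomp Require Import all_boot all_order all_algebra.
From mathcomp Require Import all_classical all_reals all_analysis.
From mathcomp Require Import complex.
Set Implicit Arguments.
Unset Strict Implicit.
Unset Printing Implicit Defensive.
Import Order.TTheory GRing.Theory Num.Theory.
Import numFieldNormedType.Exports.
Local Open Scope classical_set_scope.
Local Open Scope ring_scope.

Section Topology.

Definition homeo_on {S T : topologicalType} (A : set S) (B : set T)
    (f : S -> T) : Prop :=
  [/\ set_bij A B f, {within A, continuous f} &
      exists2 g : T -> S, {within B, continuous g} &
        forall x, A x -> g (f x) = x].

Variable R : realType.

(* The norm of the library on 'rV[R]_n is the sup norm, so the round balls are
   written with the sum of squares.  For n = 0, [oball 0] and [cdisk 0] are the
   whole one-point space and [usphere 0] is empty. *)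
Definition sqnorm {n} (x : 'rV[R]_n) : R := \sum_(i < n) x 0 i ^+ 2.

Definition oball n : set 'rV[R]_n := [set x | sqnorm x < 1].
Definition cdisk n : set 'rV[R]_n := [set x | sqnorm x <= 1].
(* the unit sphere of R^n, of dimension n - 1 *)
Definition usphere n : set 'rV[R]_n := [set x | sqnorm x = 1].

End Topology.
Arguments oball {R} n.
Arguments cdisk {R} n.
Arguments usphere {R} n.

(* Cell structures are given by their sets of open cells: [C n e] says that [e]
   is an open n-cell.  They live on a subset [D] of a topological space, so that
   the same notion applies to S^2 and to the closed disk of the plane. *)
Section CellStructures.
Variables (R : realType) (T : topologicalType).
Implicit Types (D : set T) (C : nat -> set (set T)).

(* [skeleton C n] is the union of the cells of dimension < n.+1, and
   [below C n] of those of dimension < n. *)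
Definition below C (n : nat) : set T :=
  [set x | exists m e, [/\ (m < n)%N, C m e & e x]].
Definition skeleton C (n : nat) : set T := below C n.+1.

Definition characteristic_map C (n : nat) (e : set T) (phi : 'rV[R]_n -> T) :=
  [/\ {within cdisk n, continuous phi},
      homeo_on (oball n) e phi &
      phi @` usphere n `<=` below C n].

(* Finite CW structures of dimension at most 2; as there are finitely many
   cells, closure finiteness is automatic, and so is the weak topology in the
   Hausdorff spaces where this is used. *)
Definition cell_structure D C : Prop :=
  [/\ forall n, finite_set (C n) /\ (C n !=set0 -> (n <= 2)%N),
      \bigcup_n \bigcup_(e in C n) e = D,
      forall m n e e', C m e -> C n e' -> e `&` e' !=set0 -> m = n /\ e = e' &
      forall n e, C n e -> exists phi, characteristic_map C e phi /\
                                       phi @` cdisk n `<=` D].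

Definition tiles C : set (set T) := [set closure e | e in C 2].

Definition subdivides C' C : Prop :=
  forall n e, C' n e -> exists m e', C m e' /\ e `<=` e'.

End CellStructures.

(* [f] maps each open cell of [C] homeomorphically onto an open cell of [C'],
   necessarily of the same dimension by invariance of dimension. *)
Definition cellwise_homeo {S T : topologicalType} (C : nat -> set (set S))
    (C' : nat -> set (set T)) (f : S -> T) : Prop :=
  forall n e, C n e -> C' n (f @` e) /\ homeo_on e (f @` e) f.

Section FiniteSubdivisionRules.
Variables (R : realType) (X : topologicalType).

Definition tile_type (C : nat -> set (set X)) (e : set X)
    (t : nat -> set (set 'rV[R]_2)) (psi : 'rV[R]_2 -> X) : Prop :=
  [/\ cell_structure R (cdisk 2) t,
      skeleton t 1 = usphere 2 /\ (`I_3 #<= t 0%N)%card,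
      {within cdisk 2, continuous psi} /\ psi @` cdisk 2 = closure e &
      cellwise_homeo t C psi].

Record subdivision_rule := SubdivisionRule {
  complex0 : nat -> set (set X);
  complex1 : nat -> set (set X);
  subdivision_map : X -> X;
  complex0_cell : cell_structure R setT complex0;
  complex0_tiles : \bigcup_(t in tiles complex0) t = setT;
  complex1_cell : cell_structure R setT complex1;
  complex1_subdivides : subdivides complex1 complex0;
  subdivision_map_continuous : continuous subdivision_map;
  subdivision_map_cellular :
    forall n, subdivision_map @` skeleton complex1 n `<=` skeleton complex0 n;
  subdivision_map_homeo : cellwise_homeo complex1 complex0 subdivision_map;
  subdivision_rule_tile_type :
    forall e, complex0 2 e -> exists t psi, tile_type complex0 e t psi
}.

(* The open cells of the k-th subdivision, k >= 0.  The (k+1)-st one is pulled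
   back from the k-th one by the restrictions of the subdivision map to the open
   cells [d] of [complex1], each of which is a homeomorphism onto a union
   of cells of the k-th subdivision. *)
Fixpoint subdivision (Rl : subdivision_rule) (k : nat) : nat -> set (set X) :=
  match k with
  | 0%N => complex0 Rl
  | k'.+1 => fun n => [set e | exists m d c,
      [/\ complex1 Rl m d, subdivision Rl k' n c,
          c `<=` subdivision_map Rl @` d &
          e = d `&` subdivision_map Rl @^-1` c]]
  end.

End FiniteSubdivisionRules.

Section ThurstonMaps.
Variables (R : realType) (X : topologicalType).
(* a homeomorphism of X with the unit sphere of R^3, which orients X *)
Variable h : X -> 'rV[R]_3.

Definition to_complex (v : 'rV[R]_2) : R[i] := Complex (v 0 0) (v 0 1).

Definition chart_at (x : X) (U : set X) (phi : X -> 'rV[R]_2) : Prop :=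
  [/\ open U, U x, open (phi @` U), homeo_on U (phi @` U) phi & phi x = 0].

(* [A] is a rotation of R^3 taking [h x] to the north pole, and the loop [y]
   traced by the circle of radius [r] in the chart winds once in the positive
   direction around the vertical axis after applying [h] and then [A]. *)
Definition positive_chart (x : X) (U : set X) (phi : X -> 'rV[R]_2) : Prop :=
  \forall r \near 0^'+, exists (A : 'M[R]_3) (y : R -> X) (rho theta : R -> R),
    [/\ [/\ A *m A^T = 1%:M, \det A = 1 & h x *m A = delta_mx 0 ord_max],
        forall s, [/\ U (y s), phi (y s) 0 0 = r * cos s
                             & phi (y s) 0 1 = r * sin s],
        forall s, [/\ 0 < rho s,
                      (h (y s) *m A) 0 0 = rho s * cos (theta s) &
                      (h (y s) *m A) 0 1 = rho s * sin (theta s)],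
        continuous theta & theta (pi *+ 2) = theta 0 + pi *+ 2].

(* In suitable positive charts at x and f x, f is z |-> z ^ d. *)
Definition local_degree (f : X -> X) (x : X) (d : nat) : Prop :=
  (0 < d)%N /\ exists U V phi psi,
    [/\ chart_at x U phi /\ positive_chart x U phi,
        chart_at (f x) V psi /\ positive_chart (f x) V psi,
        f @` U `<=` V &
        forall y, U y -> to_complex (psi (f y)) = to_complex (phi y) ^+ d].

Definition branched_covering (f : X -> X) : Prop :=
  continuous f /\ forall x, exists d, local_degree f x d.

Definition critical (f : X -> X) : set X :=
  [set x | exists2 d, (1 < d)%N & local_degree f x d].

Definition postcritical (f : X -> X) : set X :=
  \bigcup_(k in [set k | (0 < k)%N]) (iter k f @` critical f).

Definition thurston_map (f : X -> X) : Prop :=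
  branched_covering f /\ finite_set (postcritical f).

(* a connected graph without simple closed curves *)
Definition is_tree (A : set X) : Prop :=
  connected A /\
  ~ exists g : 'rV[R]_2 -> X, [/\ {within usphere 2, continuous g},
      set_inj (usphere 2) g & g @` usphere 2 `<=` A].

Definition leaf (C : nat -> set (set X)) (x : X) : Prop :=
  C 0%N [set x] /\ exists! e, C 1%N e /\ closure e x.

Definition base_structure (Rl : subdivision_rule R X)
    (B : nat -> set (set X)) : Prop :=
  [/\ cell_structure R setT B /\ tiles B = [set setT],
      forall n, (n <= 1)%N -> B n `<=` complex0 Rl n,
      is_tree (skeleton B 1),
      postcritical (subdivision_map Rl) `<=` skeleton B 1 &
      leaf B `<=` postcritical (subdivision_map Rl)].

End ThurstonMaps.

Section Graphs.
Variables (R : realType) (V : Type) (adj : V -> V -> Prop).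

Inductive walk : nat -> V -> V -> Prop :=
| walk0 u : walk 0 u u
| walkS n u v w : adj u v -> walk n v w -> walk n.+1 u w.

Definition graph_dist (u v : V) : \bar R :=
  ereal_inf [set n%:R%:E | n in [set n | walk n u v]].

(* Points of the geometric realization, all edges having length 1: the point at
   distance [pos] from [src] on the edge from [src] to [tgt]. *)
Record graph_point := GraphPoint {
  src : V; tgt : V; pos : R;
  graph_point_edge : adj src tgt \/ (src = tgt /\ pos = 0);
  graph_point_pos : 0 <= pos <= 1 }.

Definition graph_point_ends (p : graph_point) : set (V * R) :=
  [set (src p, pos p); (tgt p, 1 - pos p)].

(* Lengths of the paths from p to q: those going through vertices, and those
   staying in a common edge.  For [adj] symmetric this is the path
   pseudometric; two descriptions of the same point are at distance 0. *)
Definition point_dist (p q : graph_point) : \bar R :=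
  ereal_inf (
    [set ((a.2 + b.2)%:E + graph_dist a.1 b.1)%E |
       a in graph_point_ends p & b in graph_point_ends q]
    `|` [set l | [/\ src p = src q, tgt p = tgt q & l = `|pos p - pos q|%:E]]
    `|` [set l | [/\ src p = tgt q, tgt p = src q
                   & l = `|pos p - (1 - pos q)|%:E]]).

Definition gromov_product {T : Type} (d : T -> T -> R) (w x y : T) : R :=
  (d x w + d y w - d x y) / 2.

Definition gromov_hyperbolic {T : Type} (d : T -> T -> R) : Prop :=
  exists delta : R, forall w x y z,
    Num.min (gromov_product d w x y) (gromov_product d w y z) - delta
      <= gromov_product d w x z.

(* For a connected graph, the distance is finite and [fine] loses nothing. *)
Definition hyperbolic_graph : Prop :=
  gromov_hyperbolic (fun p q => fine (point_dist p q)).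

End Graphs.

Section FatPathSubdivisionGraph.
Variables (R : realType) (X : topologicalType).
Variables (Rl : subdivision_rule R X) (B : nat -> set (set X)).

(* the cell structure of level k >= -1; [Negz 0] is -1 *)
Definition level_complex (k : int) : nat -> set (set X) :=
  match k with
  | Posz k => subdivision Rl k
  | Negz 0 => B
  | Negz _ => fun _ => set0
  end.

Definition fat_vertices : set (int * set X) :=
  [set v | tiles (level_complex v.1) v.2].

Definition fat_vertex : Type := fat_vertices.

Definition level (v : fat_vertex) : int := (val v).1.
Definition tile (v : fat_vertex) : set X := (val v).2.

Definition vertical (u v : fat_vertex) : Prop :=
  level v = level u + 1 /\ tile v `<=` tile u.

Definition horizontal (u v : fat_vertex) : Prop :=
  [/\ level u = level v, tile u <> tile v &
      exists2 e, level_complex (level u) 1 e &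
                 closure e `<=` tile u `&` tile v].

Definition fat_edge (u v : fat_vertex) : Prop :=
  [\/ vertical u v, vertical v u | horizontal u v].

Definition level_dist (k : int) : fat_vertex -> fat_vertex -> \bar R :=
  graph_dist R (fun u v => [/\ level u = k, level v = k & fat_edge u v]).

(* The value is the vertex of the tile of level m containing the tile of v;
   this tile exists and is unique if -1 <= m <= level v. *)
Definition transition (m : int) (v : fat_vertex) : fat_vertex :=
  xget v [set u : fat_vertex | level u = m /\ tile v `<=` tile u].

End FatPathSubdivisionGraph.

(* Main.v *)
Require Import Defs.
From mathcomp Require Import all_boot all_order all_algebra.
From mathcomp Require Import all_classical all_reals all_analysis.
From mathcomp Require Import complex.
From mathcomp Require Import zify ring lra.
Set Implicit Arguments.
Unset Strict Implicit.
Unset Printing Implicit Defensive.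
Import Order.TTheory GRing.Theory Num.Theory.
Import numFieldNormedType.Exports.
Local Open Scope classical_set_scope.
Local Open Scope ring_scope.

(** Vertical edges make the tiles into a rooted tree: a tile is contained in
    exactly one tile of the previous level, and the root is the whole sphere.
    Going up this tree does not increase horizontal distances
    (horizontal_parent): if two tiles have a common edge, this edge lies inside
    a coarser tile, which then contains both, or inside a coarser edge, which
    their parents then have in common.  For such trees with horizontal edges,
    every walk can be replaced by one that goes up, across and down, and is not
    longer (walk_normal_form).

    Suppose that distances expand.  Read upwards, a horizontal walk of length M
    loses at least one step in n levels; so a walk of length 2 * M is halved in
    M * n levels, and so are long walks, up to a constant (near_halve).  Hence
    the horizontal part of a geodesic is bounded, since otherwise going up a few
    more levels would be shorter.  The distance from u to v is therefore, up to
    a constant, depth u + depth v - 2 c, where c is the last level at which the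
    ancestors of u and v are close, and c is an ultrametric up to a constant.
    This is hyperbolicity (contracting_hyperbolic).

    Suppose conversely that the graph is hyperbolic with constant delta.  If
    the expansion failed for a large M, a horizontal walk of length M would not
    become shorter over many levels above it, and would be a geodesic.  A
    long horizontal geodesic contradicts hyperbolicity, because its midpoint is
    as far from the root as its ends are (hyperbolic_contracting).

    Two facts about tiles enter.  A tile that meets an open edge of its level
    contains it (edge_sub_closure).  At level 0 this is clear from the tile types.  At
    level k, the map f^k is a local homeomorphism at the points of open edges,
    because the degree there is one, so half disks of the tile types can be
    lifted.  Moreover any two tiles of one level are joined by a chain of tiles
    with common edges (tile_graph_connected), so that horizontal distances are
    finite and the strict inequality makes sense: the sphere without the
    vertices is connected. *)

(** * Walks in graphs *)
Section Walks.
Local Open Scope nat_scope.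
Variables (V : Type) (E : V -> V -> Prop).

Lemma walk_cat m n u v w : walk E m u v -> walk E n v w -> walk E (m + n) u w.
Proof.
elim=> [//|k x y z xy _ IH zw]; rewrite addSn; apply: walkS xy _; exact: IH.
Qed.

Lemma walk1 u v : E u v -> walk E 1 u v.
Proof. by move=> uv; apply: walkS uv _; exact: walk0. Qed.

Lemma walk_sym : (forall u v, E u v -> E v u) ->
  forall n u v, walk E n u v -> walk E n v u.
Proof.
move=> sE n u v; elim=> [x|k x y z xy _ IH]; first exact: walk0.
by rewrite -addn1; apply: walk_cat IH _; exact/walk1/sE.
Qed.

Lemma walk_split m n u w :
  walk E (m + n) u w -> exists2 v, walk E m u v & walk E n v w.
Proof.
elim: m u => [|m IH] u; first by rewrite add0n => W; exists u => //; exact: walk0.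
rewrite addSn => W; inversion W as [|k x y z xy yw]; subst.
by have [v yv vw] := IH _ yw; exists v => //; apply: walkS xy yv.
Qed.

Lemma walk_sub (E' : V -> V -> Prop) : (forall u v, E u v -> E' u v) ->
  forall n u v, walk E n u v -> walk E' n u v.
Proof.
move=> EE n u v; elim=> [x|k x y z xy _ IH]; first exact: walk0.
exact: walkS (EE _ _ xy) IH.
Qed.

Definition near_by L u v := exists2 n, n <= L & walk E n u v.

Lemma near_refl L u : near_by L u u.
Proof. by exists 0 => //; exact: walk0. Qed.

Lemma near_trans L L' u v w :
  near_by L u v -> near_by L' v w -> near_by (L + L') u w.
Proof.
move=> [n nL uv] [n' nL' vw]; exists (n + n'); first by rewrite leq_add.
exact: walk_cat uv vw.
Qed.

Lemma near_le L L' u v : L <= L' -> near_by L u v -> near_by L' u v.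
Proof. by move=> LL' [n nL uv]; exists n => //; exact: leq_trans LL'. Qed.

Lemma near_split L L' u w :
  near_by (L + L') u w -> exists2 v, near_by L u v & near_by L' v w.
Proof.
move=> [n nL W]; case: (leqP n L) => nL'.
  by exists w; [exists n | exact: near_refl].
move: W; rewrite -(subnKC (ltnW nL')) => /walk_split[v uv vw].
by exists v; [exists L | exists (n - L) => //; rewrite leq_subLR].
Qed.

End Walks.

(** * Gromov hyperbolicity *)
Section GromovHyperbolicity.
Variable R : realType.

(** Hyperbolicity only depends on distances up to a bounded error, which lets
    vertices stand for all points of a graph. *)
Lemma gromov_hyperbolic_perturb (S T : Type) (f : S -> T)
    (d : S -> S -> R) (d' : T -> T -> R) (C : R) :
  (forall t, exists s, f s = t) ->
  (forall x y, `|d x y - d' (f x) (f y)| <= C) ->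
  gromov_hyperbolic d <-> gromov_hyperbolic d'.
Proof.
move=> f_surj dd'.
(* a Gromov product is half of a combination of three distances *)
have prod x y w : `|gromov_product d w x y - gromov_product d' (f w) (f x) (f y)|
    <= 3 / 2 * C.
  have := dd' x w; have := dd' y w; have := dd' x y.
  rewrite /gromov_product !ler_norml => /andP[? ?] /andP[? ?] /andP[? ?].
  by apply/andP; split; lra.
split=> -[delta hyp]; exists (delta + 3 * C) => w x y z; last first.
  have := hyp (f w) (f x) (f y) (f z).
  have := prod x y w; have := prod y z w; have := prod x z w.
  rewrite !ler_norml => /andP[? ?] /andP[? ?] /andP[? ?].
  rewrite !lerBlDr !ge_min => /orP[?|?]; apply/orP; [left|right]; lra.
have [[w' <-] [x' <-]] := (f_surj w, f_surj x).
have [[y' <-] [z' <-]] := (f_surj y, f_surj z).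
have := hyp w' x' y' z'.
have := prod x' y' w'; have := prod y' z' w'; have := prod x' z' w'.
rewrite !ler_norml => /andP[? ?] /andP[? ?] /andP[? ?].
rewrite !lerBlDr !ge_min => /orP[?|?]; apply/orP; [left|right]; lra.
Qed.

(** In a rooted tree, d u v = lev u + lev v - 2 * c u v, where c u v is the
    level of the last common ancestor, and c satisfies the ultrametric
    inequality.  If both hold up to constants then in the four point condition
    all levels cancel, and what remains are the ultrametric inequalities for
    the four triples of points. *)
Lemma quasi_ultrametric_hyperbolic (V : Type) (lev : V -> nat)
    (d c : V -> V -> nat) (K D : nat) :
  (forall u v, c u v = c v u) ->
  (forall u v w, (minn (c u v) (c v w) <= c u w + D)%N) ->
  (forall u v, (lev u + lev v <= d u v + 2 * c u v)%N) ->
  (forall u v, (d u v + 2 * c u v <= lev u + lev v + K)%N) ->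
  gromov_hyperbolic (fun u v => (d u v)%:R : R).
Proof.
move=> cC c_ultra d_ge d_le.
have [C C_def] : {C | C = 4 * D + 4 * K}%N by exists (4 * D + 4 * K)%N.
exists (C%:R / 2) => w x y z.
have four : (d y w + d x z <= d x y + d z w + C)%N \/
            (d y w + d x z <= d y z + d x w + C)%N.
  have := c_ultra x y z; have := c_ultra x w z.
  have := c_ultra y x w; have := c_ultra y z w.
  rewrite (cC y x) (cC w z).
  have := d_le y w; have := d_le x z; have := d_ge x y; have := d_ge z w.
  have := d_ge y z; have := d_ge x w; lia.
rewrite lerBlDr ge_min /gromov_product.
by apply/orP; case: four => four; [left|right];
  move: four; rewrite -(ler_nat R) !natrD; lra.
Qed.

End GromovHyperbolicity.

(** * Rooted trees with horizontal edges

    The vertices form a rooted tree in which par v is the parent of v, the root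
    being its own parent; H is the relation of the horizontal edges, and E that
    of all edges, vertical or horizontal. *)
Section AugmentedTree.
Local Open Scope nat_scope.
Variables (V : Type) (lev : V -> nat) (par : V -> V).
Variables (H E : V -> V -> Prop).
Hypothesis lev_par : forall v, lev (par v) = (lev v).-1.
Hypothesis root_unique : forall u v, lev u = 0 -> lev v = 0 -> u = v.
Hypothesis H_lev : forall u v, H u v -> lev u = lev v.
Hypothesis H_sym : forall u v, H u v -> H v u.
Hypothesis H_par : forall u v, H u v -> par u = par v \/ H (par u) (par v).
Hypothesis E_P : forall u v, E u v <->
  [\/ u = par v /\ lev v = (lev u).+1, v = par u /\ lev u = (lev v).+1 | H u v].

Local Notation up i := (iter i par).
Local Notation near := (near_by H).

Lemma lev_up i v : lev (up i v) = lev v - i.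
Proof. by elim: i => [|i /= IH]; rewrite ?subn0 // lev_par IH subnS. Qed.

Lemma edge_sym u v : E u v -> E v u.
Proof.
by move/E_P => uv; apply/E_P; case: uv => [?|?|/H_sym ?];
  [constructor 2|constructor 1|constructor 3].
Qed.

Lemma near_lev L u v : near L u v -> lev u = lev v.
Proof.
by case=> n _; elim=> [//|k x y z /H_lev -> _ ->].
Qed.

Lemma near_sym L u v : near L u v -> near L v u.
Proof. by case=> n nL /(walk_sym H_sym) vu; exists n. Qed.

Lemma near_par L u v : near L u v -> near L (par u) (par v).
Proof.
case=> n nL uv; apply: (near_le nL); elim: uv => {n nL u v} [u|n x y z xy _ IH].
  exact: near_refl.
case: (H_par xy) => [->|pxy]; first exact: near_le IH.
by rewrite -add1n; apply: near_trans IH; exists 1 => //; exact: walk1.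
Qed.

Lemma near_up i L u v : near L u v -> near L (up i u) (up i v).
Proof. by move=> uv; elim: i => [//|i IH] /=; exact: near_par. Qed.

Lemma near_root L u v : lev u = 0 -> lev v = 0 -> near L u v.
Proof. by move=> u0 v0; rewrite (root_unique u0 v0); exact: near_refl. Qed.

Lemma walk_up i u : i <= lev u -> walk E i u (up i u).
Proof.
elim: i => [|i IH] iu; first exact: walk0.
rewrite -{1}addn1; apply: (walk_cat (IH (ltnW iu))); apply: walk1; apply/E_P.
by constructor 2; split=> //; rewrite !lev_up; lia.
Qed.

Lemma walk_down i u : i <= lev u -> walk E i (up i u) u.
Proof. by move=> iu; apply: (walk_sym edge_sym); exact: walk_up. Qed.

Lemma near_walk L u v : near L u v -> exists2 n, n <= L & walk E n u v.
Proof.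
case=> n nL uv; exists n => //; apply: walk_sub uv => x y xy.
by apply/E_P; constructor 3.
Qed.

Lemma walk_via i L k u v : i <= lev u -> k <= lev v ->
  near L (up i u) (up k v) -> exists2 n, n <= i + L + k & walk E n u v.
Proof.
move=> iu kv /near_walk[n nL W]; exists (i + n + k).
  by rewrite leq_add2r leq_add2l.
by apply: walk_cat (walk_down kv); apply: walk_cat W; exact: walk_up.
Qed.

(** Every walk can be replaced by one that goes up, then across, then down, and
    is not longer: a step down followed by a step up ends where it started, and
    a horizontal step followed by a step up can be replaced by the step up
    followed by at most one horizontal step, by H_par. *)
Lemma walk_normal_form n u v : walk E n u v -> exists i h k,
  [/\ i + h + k <= n, i <= lev u, k <= lev v & near h (up i u) (up k v)].
Proof.
elim=> {n u v} [u|n u w v /E_P uw _ [i [h [k [ihk iw kv W]]]]].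
  by exists 0, 0, 0; split=> //; exact: near_refl.
case: uw => [[uw lw]|[wu lu]|uw].
- case: i => [|i] in ihk iw W.
    have := near_lev W; rewrite /= lev_up => lwv.
    exists 0, h, k.+1; split; [lia|lia|lia|].
    by rewrite /= uw; exact: (near_par W).
  exists i, h, k; split; [lia|lia|lia|].
  by move: W; rewrite iterSr -uw.
- exists i.+1, h, k; split; [lia|lia|lia|].
  by rewrite iterSr -wu.
- exists i, (h.+1), k; split; [lia| |lia|]; first by rewrite (H_lev uw).
  rewrite -add1n; apply: near_trans W; apply: near_up.
  by exists 1 => //; exact: walk1.
Qed.

Variable d : V -> V -> nat.
Hypothesis d_walk : forall u v, walk E (d u v) u v.
Hypothesis d_min : forall n u v, walk E n u v -> d u v <= n.

Lemma dist_via i L k u v : i <= lev u -> k <= lev v ->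
  near L (up i u) (up k v) -> d u v <= i + L + k.
Proof. by move=> iu kv /(walk_via iu kv)[n nL /d_min]; lia. Qed.

Lemma dist_to_root u v : lev v = 0 -> d u v = lev u.
Proof.
move=> v0; apply/eqP; rewrite eqn_leq; apply/andP; split.
  apply: leq_trans (@dist_via (lev u) 0 0 u v _ _ _) _; rewrite ?addn0 //.
  by apply: near_root; rewrite lev_up ?subnn ?v0.
have [i [h [k [le iu kv /near_lev]]]] := walk_normal_form (d_walk u v).
rewrite !lev_up; lia.
Qed.

(** The hypothesis contracting is the expansion property read upwards. *)
Section Contracting.
Variables M n : nat.
Hypothesis M_gt0 : 0 < M.
Hypothesis contracting : forall u v, near M u v -> near M.-1 (up n u) (up n v).

(** Splitting off a piece of length M, which becomes shorter, while the
    rest does not become longer, removes one step every n levels. *)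
Lemma near_contract k u v : near (M + k) u v -> near M (up (k * n) u) (up (k * n) v).
Proof.
elim: k u v => [|k IH] u v; first by rewrite addn0.
move=> uv; have [w uw wv] := near_split uv; rewrite mulSn addnC !iterD; apply: IH.
have -> : M + k = M.-1 + k.+1 by lia.
exact: near_trans (contracting uw) (near_up n wv).
Qed.

(** number of levels over which walks of length 2 * M are shortened to M *)
Let T := M * n.

(** A long walk is cut into pieces of length 2 * M, each of which is halved. *)
Lemma near_halve L u v : near L u v -> near (L./2 + M) (up T u) (up T v).
Proof.
elim/ltn_ind: L u v => L IH u v uv.
have [L_le|L_gt] := leqP L (M + M).
  by apply: (@near_le _ _ M); [lia | apply: near_contract; exact: near_le uv].
move: uv; have -> : L = (M + M) + (L - (M + M)) by lia.
move=> uv; have [w /near_contract uw wv] := near_split uv.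
have {wv} wv := IH (L - (M + M)) ltac:(lia) _ _ wv.
apply: near_le (near_trans uw wv); lia.
Qed.

(** The horizontal part of a geodesic has length at most K.  The multiple of M
   is large enough for two halvings to bring 2 * K back to K. *)
Let K := 4 * T + 6 * M + 1.

Let anc j u := up (lev u - j) u.

Let meets u v j := `[< [/\ j <= lev u, j <= lev v & near K (anc j u) (anc j v)] >].

Lemma meets_root u v : exists j, meets u v j.
Proof. by exists 0; apply/asboolP; split=> //; apply: near_root; rewrite lev_up; lia. Qed.

Lemma meets_le u v j : meets u v j -> j <= lev u.
Proof. by case/asboolP. Qed.

(** In a tree, with K = 0, this is the level of the last common ancestor. *)
Let meeting u v := ex_maxn (meets_root u v) (@meets_le u v).

Lemma meets_meeting u v : meets u v (meeting u v).
Proof. by rewrite /meeting; case: ex_maxnP. Qed.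

Lemma meeting_max u v j : meets u v j -> j <= meeting u v.
Proof. by rewrite /meeting; case: ex_maxnP => i _; exact. Qed.

Lemma anc_near L u v j i : j <= lev u -> j <= lev v ->
  near L (anc j u) (anc j v) -> near L (anc (j - i) u) (anc (j - i) v).
Proof.
move=> ju jv; have [ij|ji] := leqP i j.
  move=> /(near_up i); rewrite /anc -!iterD.
  by have [-> ->] : i + (lev u - j) = lev u - (j - i) /\
                    i + (lev v - j) = lev v - (j - i) by lia.
by move=> _; apply: near_root; rewrite lev_up; lia.
Qed.

Lemma meeting_sym u v : meeting u v = meeting v u.
Proof.
apply/eqP; rewrite eqn_leq; apply/andP; split; apply: meeting_max.
  by have /asboolP[? ? W] := meets_meeting u v; apply/asboolP; split=> //; exact: near_sym W.
by have /asboolP[? ? W] := meets_meeting v u; apply/asboolP; split=> //; exact: near_sym W.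
Qed.

(** At the smaller of the two levels the ancestors of u and w are at most 2 * K
    apart, and they come within K after two halvings. *)
Lemma meeting_ultrametric u v w : minn (meeting u v) (meeting v w) <= meeting u w + 2 * T.
Proof.
have /asboolP[uc vc uv] := meets_meeting u v.
have /asboolP[vc' wc vw] := meets_meeting v w.
set j := minn _ _.
have := @anc_near _ _ _ _ (meeting u v - j) uc vc uv.
have := @anc_near _ _ _ _ (meeting v w - j) vc' wc vw.
have -> : meeting u v - (meeting u v - j) = j by lia.
have -> : meeting v w - (meeting v w - j) = j by lia.
move=> vw' uv'; have uw := near_halve (near_halve (near_trans uv' vw')).
have [le|lt] := leqP (T + T) j; last lia.
suff : j - (T + T) <= meeting u w by lia.
apply: meeting_max; apply/asboolP; split; [lia|lia|].
move: uw; rewrite /anc -!iterD !addnA.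
have [-> ->] : T + T + (lev u - j) = lev u - (j - (T + T)) /\
               T + T + (lev w - j) = lev w - (j - (T + T)) by lia.
by apply: near_le; lia.
Qed.

Lemma dist_le_meeting u v : d u v + 2 * meeting u v <= lev u + lev v + K.
Proof.
have /asboolP[uc vc /dist_via] := meets_meeting u v.
by move=> /(_ (leq_subr _ _) (leq_subr _ _)); lia.
Qed.

(** A geodesic goes up, across and down.  If its horizontal part were longer
    than K, going up T more levels to halve that part, or going through the
    root if this is closer, would give a shorter walk. *)
Lemma dist_ge_meeting u v : lev u + lev v <= d u v + 2 * meeting u v.
Proof.
have [i [h [k [le iu kv W]]]] := walk_normal_form (d_walk u v).
have := near_lev W; rewrite !lev_up => lev_eq.
have hK : h <= K.
  have [Tj|jT] := leqP T (lev u - i).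
    have := near_halve W; rewrite -!iterD => /dist_via; rewrite /K; lia.
  have := @dist_via (lev u) 0 (lev v) u v (leqnn _) (leqnn _).
  by rewrite /K => /(_ (near_root _ _ _)); rewrite !lev_up !subnn; lia.
suff : lev u - i <= meeting u v by lia.
apply: meeting_max; apply/asboolP; split; [lia|lia|].
rewrite /anc {2}lev_eq !subKn //; exact: near_le W.
Qed.

Lemma contracting_hyperbolic (R : realType) :
  gromov_hyperbolic (fun u v => (d u v)%:R : R).
Proof.
exact: quasi_ultrametric_hyperbolic meeting_sym meeting_ultrametric
  dist_ge_meeting dist_le_meeting.
Qed.

End Contracting.

(** Take q > 2 * delta.  If a horizontal walk of length 2 * q from u to v did not
    become shorter in 2 * q levels, it would be a geodesic for d: a walk that
    goes up fewer levels still has to cross a distance 2 * q, and one that goes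
    up more is longer already.  Its midpoint w would have the same level l as u
    and v.  With the root as base point, the Gromov product of u and v is l - q,
    whereas those of u and w and of w and v are at least l - q / 2, so that
    q <= 2 * delta. *)
Lemma hyperbolic_contracting (R : realType) (r : V) : lev r = 0 ->
  gromov_hyperbolic (fun u v => (d u v)%:R : R) ->
  exists M n : nat, [/\ 0 < M, 0 < n &
    forall u v, near M u v -> near M.-1 (up n u) (up n v)].
Proof.
move=> r0 [delta hyp].
have [q q_gt0 q_delta] : exists2 q, 0 < q & (2 * delta < q%:R)%R.
  exists (Num.bound `|2 * delta|%R).+1 => //.
  apply: le_lt_trans (ler_norm _) _; apply: lt_trans (archi_boundP _) _ => //.
  by rewrite ltr_nat.
exists (2 * q), (2 * q); split; [lia|lia|move=> u v uv].
apply: contrapT => far.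
have uv_lev := near_lev uv.
have d_uv : d u v = 2 * q.
  apply/eqP; rewrite eqn_leq; apply/andP; split.
    by apply: leq_trans (@dist_via 0 _ 0 u v _ _ uv) _; rewrite ?addn0.
  have [i [h [k [le iu kv W]]]] := walk_normal_form (d_walk u v).
  have := near_lev W; rewrite !lev_up => lev_eq.
  have ki : k = i by lia.
  have [|h_lt] := leqP (2 * q) h; first lia.
  have [i_le|] := leqP i (2 * q); last lia.
  case: far; rewrite -(subnK i_le) !iterD; apply: near_up.
  by rewrite ki in W; apply: near_le W; lia.
have [w uw wv] : exists2 w, near q u w & near q w v.
  by apply: near_split; move: uv; rewrite mul2n addnn.
have := hyp r u w v; rewrite /gromov_product !(dist_to_root _ r0) -uv_lev.
rewrite -(near_lev uw) d_uv lerBlDr ge_min.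
have d_uw : d u w <= q by have := @dist_via 0 _ 0 u w isT isT uw; rewrite addn0.
have d_wv : d w v <= q by have := @dist_via 0 _ 0 w v isT isT wv; rewrite addn0.
move: d_uw d_wv q_delta; rewrite -!(ler_nat R) natrM.
by move=> ? ? ? /orP[]; lra.
Qed.

End AugmentedTree.

(** * Homeomorphisms and local homeomorphisms *)
Section Homeomorphisms.

Lemma within_continuousP (S T : topologicalType) (A : set S) (f : S -> T) :
  {within A, continuous f} <->
  forall x, A x -> forall W, nbhs (f x) W ->
    exists2 U, nbhs x U & forall y, U y -> A y -> W (f y).
Proof.
rewrite subspace_continuousP; split=> cf x Ax W.
  move=> /(cf x Ax) fW; exists [set y | A y -> W (f y)] => [|y]; last exact.
  exact: fW.
move=> /(cf x Ax)[U xU UW].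
by rewrite /nbhs /= /within /=; apply: filterS xU => y Uy Ay; exact: UW.
Qed.

Lemma continuous_comp_within (S T U : topologicalType) (A : set S) (B : set T)
    (f : S -> T) (g : T -> U) :
  {homo f : x / A x >-> B x} -> {within A, continuous f} ->
  {within B, continuous g} -> {within A, continuous (g \o f)}.
Proof.
move=> AB /within_continuousP cf /within_continuousP cg.
apply/within_continuousP => x Ax W /(cg _ (AB _ Ax))[V fV VW].
have [N xN NV] := cf _ Ax _ fV.
by exists N => // y Ny Ay; apply: VW; [exact: NV|exact: AB].
Qed.

Lemma homeo_on_sub (S T : topologicalType) (A A' : set S) (B : set T)
    (f : S -> T) :
  A' `<=` A -> homeo_on A B f -> homeo_on A' (f @` A') f.
Proof.
move=> A'A [[fAB fI fS] cf [g cg gK]]; split.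
- apply: inj_bij => x y; rewrite !inE => A'x A'y.
  by apply: fI; rewrite inE; exact: A'A.
- exact: continuous_subspaceW A'A cf.
- exists g; last by move=> x /A'A; exact: gK.
  by apply: continuous_subspaceW cg => _ [x /A'A Ax <-]; exact: fAB.
Qed.

Lemma homeo_on_comp (S T U : topologicalType) (A : set S) (B : set T)
    (C : set U) (f : S -> T) (g : T -> U) :
  homeo_on A B f -> homeo_on B C g -> homeo_on A C (g \o f).
Proof.
move=> [[fAB fI fS] cf [f' cf' fK]] [[gBC gI gS] cg [g' cg' gK]]; split.
- split.
  + by move=> x Ax; apply: gBC; exact: fAB.
  + move=> x y /set_mem Ax /set_mem Ay /= eq; apply: fI; rewrite ?inE //.
    by apply: gI; rewrite ?inE //; exact: fAB.
  + by move=> z /gS[y /fS[x Ax <-] <-]; exists x.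
- exact: continuous_comp_within fAB cf cg.
- exists (f' \o g'); last by move=> x Ax /=; rewrite gK ?fK //; exact: fAB.
  apply: continuous_comp_within cg' cf' => z /gS[y By <-].
  by rewrite gK.
Qed.

Lemma homeo_on_inverse (S T : topologicalType) (A : set S) (B : set T)
    (f : S -> T) : homeo_on A B f ->
  exists g, [/\ homeo_on B A g, {homo g : y / B y >-> A y},
    {homo f : x / A x >-> B x},
    forall x, A x -> g (f x) = x & forall y, B y -> f (g y) = y].
Proof.
move=> [[fAB fI fS] cf [g cg gK]]; exists g.
have gBA : {homo g : y / B y >-> A y} by move=> _ /fS[x Ax <-]; rewrite gK.
have fK y : B y -> f (g y) = y by move=> /fS[x Ax <-]; rewrite gK.
split=> //; split=> //; last by exists f.
split=> //.
  move=> x y /set_mem Bx /set_mem By eq.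
  by rewrite -(fK _ Bx) -(fK _ By) eq.
by move=> x Ax; exists (f x); [exact: fAB|exact: gK].
Qed.

Lemma homeo_on_image (S T : topologicalType) (A : set S) (B : set T)
    (f : S -> T) : homeo_on A B f -> f @` A = B.
Proof.
move=> [[fAB _ fS] _ _]; apply/seteqP; split; last exact: fS.
by move=> _ [x Ax <-]; exact: fAB.
Qed.

Lemma homeo_on_eq (S T : topologicalType) (A : set S) (B : set T) (f g : S -> T) :
  (forall x, A x -> f x = g x) -> homeo_on A B f -> homeo_on A B g.
Proof.
move=> fg [bf cf [f' cf' f'K]]; split.
- by rewrite -(eq_set_bij _ (f := f)) // => x /set_mem; exact: fg.
- by apply: subspace_eq_continuous cf => x /set_mem; exact: fg.
- by exists f' => // x Ax; rewrite -fg // f'K.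
Qed.

Lemma homeo_on_id (T : topologicalType) (A : set T) : homeo_on A A id.
Proof.
split; first by split=> // x Ax; exists x.
  by apply: continuous_subspaceT => x.
by exists id => //; apply: continuous_subspaceT => x.
Qed.

Definition local_homeo_at {S T : topologicalType} (f : S -> T) (x : S) :=
  exists U, [/\ open U, U x, open (f @` U) & homeo_on U (f @` U) f].

Lemma local_homeo_shrink (S T : topologicalType) (f : S -> T) (x : S) W :
  local_homeo_at f x -> nbhs x W ->
  exists U, [/\ open U, U x, U `<=` W, open (f @` U) & homeo_on U (f @` U) f].
Proof.
move=> [U [oU Ux ofU hU]]; rewrite nbhsE => -[V [oV Vx] VW].
exists (U `&` V); split=> //; first exact: openI.
- by move=> y [_ /VW].
- have [g [[_ cg _] gU fU gK fK]] := homeo_on_inverse hU.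
  have -> : f @` (U `&` V) = f @` U `&` g @^-1` V.
    apply/seteqP; split=> [_ [y [Uy Vy] <-]|y [fUy Vy]].
      by split; [exists y|rewrite /preimage /= gK].
    by exists (g y); [split=> //; exact: gU|exact: fK].
  rewrite continuous_open_subspace // in cg.
  exact: (proj1 (continuous_inP _ ofU) cg).
- exact: homeo_on_sub hU.
Qed.

Lemma local_homeo_comp (S T U : topologicalType) (f : S -> T) (g : T -> U)
    (x : S) :
  local_homeo_at f x -> local_homeo_at g (f x) -> local_homeo_at (g \o f) x.
Proof.
move=> hf hg; have [V [oV Vfx ogV hV]] := hg.
have [W [oW Wx ofW hW]] := hf.
have [V' [oV' V'fx V'W ogV' hV']] : exists V', [/\ open V', V' (f x),
    V' `<=` f @` W, open (g @` V') & homeo_on V' (g @` V') g].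
  by apply: local_homeo_shrink => //; apply: open_nbhs_nbhs; split=> //; exists x.
have [f' [[_ cf' _] f'W fW f'K fK]] := homeo_on_inverse hW.
have [_ cf _] := hW.
have imU : f @` (W `&` f @^-1` V') = V'.
  apply/seteqP; split=> [_ [y [_ ?] <-] //|y V'y].
  have fWy := V'W _ V'y; exists (f' y); last exact: fK.
  by split; [exact: f'W|rewrite /preimage /= fK].
exists (W `&` f @^-1` V'); split=> //.
- rewrite continuous_open_subspace // in cf.
  exact: (proj1 (continuous_inP _ oW) cf).
- by rewrite -image_comp imU.
- rewrite -image_comp imU; apply: homeo_on_comp hV'.
  by rewrite -[in X in homeo_on _ X](imU); apply: homeo_on_sub hW => y [].
Qed.

Lemma local_homeo_id (T : topologicalType) (x : T) : local_homeo_at id x.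
Proof.
exists setT; rewrite image_id; split=> //; try exact: openT.
exact: homeo_on_id.
Qed.

End Homeomorphisms.

(** * Balls and spheres *)
Section EuclideanBalls.
Variable R : realType.

Lemma sqnorm_continuous n : continuous (@sqnorm R n).
Proof.
have -> : @sqnorm R n = \sum_(i < n) (fun x : 'rV[R]_n => x 0 i ^+ 2).
  by apply/funext => x; rewrite /sqnorm fct_sumE.
elim/big_ind: _ => [x|f g cf cg x|i _ x].
- exact: (@cst_continuous _ _ (0 : R)).
- exact: (continuousD (cf x) (cg x)).
- exact: (continuous_comp (@coord_continuous _ _ _ 0 i x) (@exprn_continuous _ 2 _)).
Qed.

Lemma open_oball n : open (oball n : set 'rV[R]_n).
Proof.
by apply: (open_comp _ (@open_lt _ 1)) => x _; exact: sqnorm_continuous.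
Qed.

Lemma oball_cdisk n : oball n `<=` (cdisk n : set 'rV[R]_n).
Proof. by move=> x; exact: ltW. Qed.

Lemma cdiskE n : (cdisk n : set 'rV[R]_n) = oball n `|` usphere n.
Proof.
apply/seteqP; split=> x; rewrite /cdisk /oball /usphere /=.
  by rewrite le_eqVlt => /orP[/eqP ?|?]; [right|left].
by case=> [/ltW|->].
Qed.

Lemma sqnorm0 n : sqnorm (0 : 'rV[R]_n) = 0.
Proof. by rewrite /sqnorm big1 // => i _; rewrite mxE expr0n. Qed.

Lemma oball0 n : oball n (0 : 'rV[R]_n).
Proof. by rewrite /oball /= sqnorm0. Qed.

Lemma sqnorm_coord n (x : 'rV[R]_n) i : x 0 i ^+ 2 <= sqnorm x.
Proof.
rewrite /sqnorm (bigD1 i) //= lerDl; apply: sumr_ge0 => j _; exact: sqr_ge0.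
Qed.

Lemma rV_norm_le n (x : 'rV[R]_n) (M : R) :
  0 <= M -> (forall i, `|x 0 i| <= M) -> `|x| <= M.
Proof.
move=> M0 xM; rewrite /Num.norm /= mx_normrE; apply/bigmax_leP; split=> //= i _.
by rewrite (ord1 i.1).
Qed.

Lemma compact_cdisk n : compact (cdisk n : set 'rV[R]_n).
Proof.
apply: bounded_closed_compact; last first.
  by apply: (closed_comp _ (@closed_le _ 1)) => x _; exact: sqnorm_continuous.
exists 1; split; first by rewrite num_real.
move=> M M1 x x1; apply: rV_norm_le => [|i]; first by apply: ltW; lra.
apply: le_trans (ltW M1); rewrite -(@ler_pXn2r _ 2) ?nnegrE // expr1n.
by rewrite real_normK ?num_real //; apply: le_trans (sqnorm_coord _ _) x1.
Qed.

End EuclideanBalls.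

(** * Cells of the iterated subdivisions *)
Section CellStructures.
Variables (R : realType) (T : topologicalType).
Implicit Types (D : set T) (C : nat -> set (set T)).

Lemma cell_finite D C : cell_structure R D C -> forall n, finite_set (C n).
Proof. by case=> fC _ _ _ n; case: (fC n). Qed.

Lemma cell_dim D C n e : cell_structure R D C -> C n e -> (n <= 2)%N.
Proof. by case=> fC _ _ _ ne; case: (fC n) => _; apply; exists e. Qed.

Lemma cell_cover D C x : cell_structure R D C -> D x -> exists n e, C n e /\ e x.
Proof. by case=> _ <- _ _ [n _ [e ne ex]]; exists n, e. Qed.

Lemma cell_unique D C m n e e' x : cell_structure R D C ->
  C m e -> C n e' -> e x -> e' x -> m = n /\ e = e'.
Proof. by case=> _ _ dC _ me ne' ex e'x; apply: dC me ne' _; exists x. Qed.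

Lemma cell_oball D C n e : cell_structure R D C -> C n e ->
  exists phi : 'rV[R]_n -> T, homeo_on (oball n) e phi.
Proof. by case=> _ _ _ cC /cC[phi [[_ h _] _]]; exists phi. Qed.

(** The image of the closed disk under the characteristic map is compact, hence
    closed. *)
Lemma cell_closure D C n e : hausdorff_space T -> cell_structure R D C ->
  C n e -> closure e `<=` e `|` below C n.
Proof.
move=> hT [_ _ _ cC] /cC[phi [[cphi hphi sphi] _]].
have clo : closed (phi @` cdisk n).
  by apply: compact_closed => //; apply: continuous_compact cphi (@compact_cdisk _ _).
have ePhi := homeo_on_image hphi.
move=> x ex; have : closure (phi @` cdisk n) x.
  by apply: closureS ex; rewrite -ePhi; apply: image_subset; exact: oball_cdisk.
rewrite -(closure_id _).1 // => -[p + <-].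
rewrite cdiskE => -[op|sp]; [left|right]; first by rewrite -ePhi; exists p.
by apply: sphi; exists p.
Qed.

End CellStructures.

Section Subdivisions.
Variables (R : realType) (X : topologicalType) (Rl : subdivision_rule R X).
Hypothesis hX : hausdorff_space X.

Local Notation f := (subdivision_map Rl).
Local Notation C k := (subdivision Rl k).

Let cell0 := complex0_cell Rl.
Let cell1 := complex1_cell Rl.
Let f_homeo := @subdivision_map_homeo R X Rl.

Lemma subdivision_sub0 k n e : C k n e -> exists m e', C 0 m e' /\ e `<=` e'.
Proof.
case: k => [|k] /= ne; first by exists n, e; split.
case: ne => m [d [c [md _ _ ->]]].
have [m' [e' [m'e' de']]] := complex1_subdivides md.
by exists m', e'; split=> // x [/de'].
Qed.

Lemma subdivision_nonempty k n e : C k n e -> e !=set0.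
Proof.
elim: k n e => [|k IH] n e /=.
  move=> /(cell_oball cell0)[phi /homeo_on_image <-].
  by exists (phi 0), 0 => //; exact: oball0.
move=> [m [d [c [md /IH[y cy] cfd ->]]]].
by have [x dx fxy] := cfd _ cy; exists x; split=> //; rewrite /preimage /= fxy.
Qed.

(** A cell of level k lies in a single cell of level 0, and f @` d is one. *)
Lemma subdivision_in_image k n c m d x :
  C k n c -> complex1 Rl m d -> c (f x) -> d x -> c `<=` f @` d.
Proof.
move=> nc md cfx dx; have [m' [e' [m'e' ce']]] := subdivision_sub0 nc.
have [mfd _] := f_homeo md.
have [_ <-] // := cell_unique cell0 m'e' mfd (ce' _ cfx) (imageP f dx).
Qed.

Lemma subdivision_cover k x : exists n e, C k n e /\ e x.
Proof.
elim: k x => [|k IH] x /=; first exact: (cell_cover cell0).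
have [m [d [md dx]]] := cell_cover cell1 (I : [set: X] x).
have [n [c [nc cfx]]] := IH (f x).
exists n, (d `&` f @^-1` c); split=> //.
by exists m, d, c; split=> //; exact: subdivision_in_image nc md cfx dx.
Qed.

Lemma subdivision_unique k m n e e' x :
  C k m e -> C k n e' -> e x -> e' x -> m = n /\ e = e'.
Proof.
elim: k m n e e' x => [|k IH] m n e e' x /=; first exact: (cell_unique cell0).
move=> [p [d [c [pd mc _ ->]]]] [p' [d' [c' [pd' nc' _ ->]]]] [dx cfx] [d'x c'fx].
have [_ ->] := cell_unique cell1 pd pd' dx d'x.
by have [-> ->] := IH _ _ _ _ _ mc nc' cfx c'fx.
Qed.

Lemma subdivision_homeo k : cellwise_homeo (C k.+1) (C k) f.
Proof.
move=> n e /= [m [d [c [md nc cfd ->]]]].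
have [_ hd] := f_homeo md.
have imc : f @` (d `&` f @^-1` c) = c.
  apply/seteqP; split=> [_ [x [_ ?] <-] //|y cy].
  by have [x dx fxy] := cfd _ cy; exists x => //; split=> //; rewrite /preimage /= fxy.
rewrite imc; split=> //.
by rewrite -[in X in homeo_on _ X](imc); apply: homeo_on_sub hd => x [].
Qed.

Lemma subdivision_iter_homeo k : cellwise_homeo (C k) (C 0) (iter k f).
Proof.
elim: k => [|k IH] n e ne.
  have -> : iter 0 f = id by [].
  by rewrite image_id; split=> //; exact: homeo_on_id.
have [nfe hfe] := subdivision_homeo ne; have [nfe' hfe'] := IH _ _ nfe.
have -> : iter k.+1 f = iter k f \o f by apply/funext => x; rewrite iterSr.
by rewrite -image_comp; split=> //; exact: homeo_on_comp hfe hfe'.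
Qed.

Lemma subdivision_dim k n e : C k n e -> (n <= 2)%N.
Proof. by case/subdivision_iter_homeo => /(cell_dim cell0). Qed.

Lemma subdivision_oball k n e : C k n e ->
  exists phi : 'rV[R]_n -> X, homeo_on (oball n) e phi.
Proof.
move=> /subdivision_iter_homeo[/(cell_oball cell0)[phi hphi] hf].
have [g [hg _ _ _ _]] := homeo_on_inverse hf.
by exists (g \o phi); exact: homeo_on_comp hphi hg.
Qed.

Lemma subdivision_finite k n : finite_set (C k n).
Proof.
elim: k n => [|k IH] n; first exact: (cell_finite cell0).
pose S := \bigcup_(m in `I_3) complex1 Rl m.
have fS : finite_set S.
  by apply: bigcup_finite => // m _; exact: (cell_finite cell1).
apply: (sub_finite_set _ (finite_image2 (fun d c => d `&` f @^-1` c) fS (IH n))).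
move=> _ /= [m [d [c [md nc _ ->]]]]; exists d; last by exists c.
by exists m => //=; rewrite ltnS; exact: cell_dim cell1 md.
Qed.

Lemma subdivision_subdivides k : subdivides (C k.+1) (C k).
Proof.
elim: k => [|k IH] n e ne.
  case: ne => m [d [c [md nc _ ->]]].
  have [m' [e' [m'e' de']]] := complex1_subdivides md.
  by exists m', e'; split=> // x [/de'].
have [m [d [c [md nc cfd ->]]]] := ne.
have {}nc : C k.+1 n c := nc.
have [m' [c' [m'c' cc']]] := IH _ _ nc.
exists m', (d `&` f @^-1` c'); split; last by move=> x [? /cc'].
exists m, d, c'; split=> //.
have [y cy] := subdivision_nonempty nc; have [x dx fxy] := cfd _ cy.
by apply: (subdivision_in_image m'c' md _ dx); apply: cc'; rewrite fxy.
Qed.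

(** A limit x of points of e = d `&` f @^-1` c is mapped into the closure of c.
    If f x is not in c, its cell has smaller dimension, and so has that of x.
    If it is, then x lies in d: otherwise its cell of level 1 would have smaller
    dimension than d, although both have the same image under f. *)
Lemma subdivision_closure k n e : C k n e -> closure e `<=` e `|` below (C k) n.
Proof.
elim: k n e => [|k IH] n e; first exact: (cell_closure hX cell0).
move=> /= [m [d [c [md nc cfd ->]]]] x edx.
have clc : closure c (f x).
  move=> B /(@subdivision_map_continuous _ _ Rl x) /edx[y [[dy cfy] Bfy]].
  by exists (f y).
have cld : closure d x by apply: closureS edx => y [].
have [n2 [e2 [n2e2 e2x]]] := subdivision_cover k.+1 x.
have [m2 [d2 [c2 [m2d2 n2c2 cfd2 e2E]]]] := n2e2.
have [d2x c2fx] : d2 x /\ c2 (f x) by move: e2x; rewrite e2E => -[].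
have [ccfx|[n3 [c3 [n3n n3c3 c3fx]]]] := IH _ _ nc _ clc; last first.
  right; exists n2, e2; split=> //.
  by have [<- _] := subdivision_unique n3c3 n2c2 c3fx c2fx.
left; split=> //; case: (cell_closure hX cell1 md cld) => // -[m4 [d4 [m4m m4d4 d4x]]].
have [m4fd4 _] := f_homeo m4d4; have [mfd _] := f_homeo md.
have [mm4 _] := cell_unique cell0 m4fd4 mfd (imageP f d4x) (cfd _ ccfx).
by rewrite mm4 ltnn in m4m.
Qed.

End Subdivisions.

(** * The subdivision map near an edge *)
Section EuclideanTopology.
Variable R : realType.

Lemma rV_continuous_at (T : topologicalType) n (F : T -> 'rV[R]_n) x :
  (forall i, {for x, continuous (fun y => F y 0 i)}) -> {for x, continuous F}.
Proof.
move=> cF W /= /nbhs_ballP[r r0 rW].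
have : \forall y \near x, forall i, ball (F x 0 i) r (F y 0 i).
  by apply: filter_forall => i; apply: (cF i); exact: nbhsx_ballx.
apply: filterS => y Fy; apply: rW; split=> // i j.
by rewrite (ord1 i); exact: Fy.
Qed.

Lemma rV_nbhs_infinite n (p : 'rV[R]_n.+1) W : nbhs p W -> infinite_set W.
Proof.
move=> /nbhs_ballP[r /= r0 rW] fW.
pose g (k : nat) := p + const_mx (r / k.+2%:R).
apply: infinite_nat; have -> : [set: nat] = g @^-1` W.
  apply/seteqP; split=> // k _; apply: rW; rewrite -ball_normE /ball_ /= /g.
  rewrite opprD addNKr normrN; apply: le_lt_trans (_ : r / k.+2%:R < r).
    apply: rV_norm_le => [|i]; first by rewrite divr_ge0 // ltW.
    by rewrite mxE ger0_norm // divr_ge0 // ltW.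
  by rewrite ltr_pdivrMr ?ltr0n // ltr_pMr // ltr1n.
apply: finite_preimage => // i j _ _ /addrI/(congr1 (fun M : 'rV_n.+1 => M 0 0)).
rewrite !mxE => /(mulfI (lt0r_neq0 r0))/invr_inj/eqP.
by rewrite eqr_nat => /eqP[].
Qed.

Lemma oball_infinite n : infinite_set (oball n.+1 : set 'rV[R]_n.+1).
Proof.
apply: (@rV_nbhs_infinite n 0); apply: open_nbhs_nbhs; split.
  exact: open_oball.
exact: oball0.
Qed.

Definition complex_mul (w : R[i]) (v : 'rV[R]_2) : 'rV[R]_2 :=
  let z := w * to_complex v in
  \row_i (if i == 0 then complex.Re z else complex.Im z).

Lemma ord2P (i : 'I_2) : i = 0 \/ i = 1.
Proof. by case: i => [[|[|//]] lt]; [left|right]; exact: val_inj. Qed.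

Lemma to_complex_inj : injective (@to_complex R).
Proof. by move=> u v [u0 u1]; apply/rowP => i; have [->|->] := ord2P i. Qed.

Lemma to_complex_mul w v : to_complex (complex_mul w v) = w * to_complex v.
Proof. by rewrite {1}/to_complex !mxE /=; case: (w * _). Qed.

Lemma complex_mul0 w : complex_mul w 0 = 0.
Proof.
apply: to_complex_inj; rewrite to_complex_mul.
have -> : to_complex 0 = 0 :> R[i] by rewrite /to_complex !mxE.
by rewrite mulr0.
Qed.

Lemma complex_mul_continuous w : continuous (complex_mul w).
Proof.
move=> v; apply: rV_continuous_at => i.
have c0 : {for v, continuous (fun y : 'rV[R]_2 => y 0 0)} by exact: coord_continuous.
have c1 : {for v, continuous (fun y : 'rV[R]_2 => y 0 1)} by exact: coord_continuous.
have cM a (g : 'rV[R]_2 -> R) : {for v, continuous g} -> {for v, continuous (fun y => a * g y)}.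
  by move=> cg; exact: (cvgM (cvg_cst a) cg).
case: w => a b; have [->|->] := ord2P i.
  rewrite (_ : (fun y => _) = (fun y : 'rV[R]_2 => a * y 0 0 - b * y 0 1)).
    exact: (cvgB (cM a _ c0) (cM b _ c1)).
  by apply/funext => y; rewrite mxE.
rewrite (_ : (fun y => _) = (fun y : 'rV[R]_2 => a * y 0 1 + b * y 0 0)).
  exact: (cvgD (cM a _ c1) (cM b _ c0)).
by apply/funext => y; rewrite mxE.
Qed.

Lemma nontrivial_root_of_unity d : (1 < d)%N ->
  exists2 w : R[i], w ^+ d = 1 & w != 1.
Proof.
move=> d1; have [|w /eqP pw_0] := closed_rootP (\poly_(i < d) (1 : R[i])) _.
  by rewrite size_poly_eq ?oner_eq0 // -(subnKC d1).
rewrite horner_poly (eq_bigr _ (fun _ _ => mul1r _)) in pw_0.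
exists w; first by apply/eqP; rewrite -subr_eq0 subrX1 pw_0 mulr0.
apply/eqP => w1; move: pw_0; rewrite w1.
rewrite (eq_bigr (fun=> 1)) => [|i _]; last by rewrite expr1n.
rewrite sumr_const card_ord => /eqP; rewrite pnatr_eq0; lia.
Qed.

End EuclideanTopology.

Section LocalDegree.
Variables (R : realType) (X : topologicalType) (h : X -> 'rV[R]_3) (f : X -> X).

Lemma chart_nbhs (x : X) U (phi : X -> 'rV[R]_2) W :
  chart_at x U phi -> nbhs x W -> nbhs (0 : 'rV[R]_2) (phi @` (U `&` W)).
Proof.
move=> [oU Ux ophU hphi phx0] xW.
have lh : local_homeo_at phi x by exists U.
have [V [oV Vx VUW ophV _]] := local_homeo_shrink lh (filterI (open_nbhs_nbhs (conj oU Ux)) xW).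
rewrite -phx0; apply: filterS (open_nbhs_nbhs (conj ophV (imageP phi Vx))).
exact: image_subset.
Qed.

(** Multiplying its coordinate in a chart by a nontrivial d-th root of unity
    moves a point near x to another point near x with the same image. *)
Lemma degree_gt1_not_inj d x W : local_degree h f x d -> (1 < d)%N -> nbhs x W ->
  \forall y \near x, y <> x -> exists y', [/\ W y', y' <> y & f y' = f y].
Proof.
move=> [_ [U [V [phi [psi [[chU _] [chV _] fUV fE]]]]]] d1 xW.
have [w wd w1] := nontrivial_root_of_unity R d1.
have [oU Ux _ [[_ phiI _] cphi _] phx0] := chU.
have [_ _ _ [[_ psiI _] _ _] _] := chV.
have N : \forall y \near x, (phi @` (U `&` W)) (complex_mul w (phi y)).
  have : {for x, continuous phi}.
    by rewrite continuous_open_subspace // in cphi; apply: cphi; rewrite inE.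
  move=> cx; have /(_ (phi @` (U `&` W))) := continuous_comp cx (@complex_mul_continuous _ w _).
  by apply; rewrite /= phx0 complex_mul0; exact: chart_nbhs chU xW.
have UN : nbhs x U by apply: open_nbhs_nbhs.
apply: filterS2 UN N => y Uy [y' [Uy' Wy'] phy'] yx.
have tc : to_complex (phi y') = w * to_complex (phi y).
  by rewrite phy' to_complex_mul.
exists y'; split=> //.
- move=> y'y; move: tc; rewrite y'y => /eqP.
  rewrite -subr_eq0 -{1}[to_complex _]mul1r -mulrBl mulf_eq0 subr_eq0 eq_sym.
  rewrite (negbTE w1) /= => /eqP z0; apply: yx; apply: phiI; rewrite ?inE //.
  rewrite phx0; apply: to_complex_inj; rewrite z0 /to_complex !mxE.
  by [].
- apply: psiI; rewrite ?inE; [by apply: fUV; exists y'|by apply: fUV; exists y|].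
  by apply: to_complex_inj; rewrite !fE // tc exprMn wd mul1r.
Qed.

Lemma degree1_local_homeo x : local_degree h f x 1 -> local_homeo_at f x.
Proof.
move=> [_ [U [V [phi [psi [[chU _] [chV _] fUV fE]]]]]].
have [oU Ux ophU hphi phx0] := chU.
have [oV Vfx opsV hpsi _] := chV.
have {}fE y : U y -> psi (f y) = phi y.
  by move=> Uy; apply: to_complex_inj; rewrite fE // expr1.
have [g [hg gV psiV gK psiK]] := homeo_on_inverse hpsi.
have phU : phi @` U `<=` psi @` V.
  by move=> _ [y Uy <-]; rewrite -fE //; apply: imageP; apply: fUV; exists y.
have gphi y : U y -> g (phi y) = f y.
  by move=> Uy; rewrite -fE // gK //; apply: fUV; exists y.
have fUE : f @` U = g @` (phi @` U).
  rewrite image_comp; apply: eq_imagel => y Uy /=; exact/esym/gphi.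
exists U; split=> //.
  have -> : f @` U = V `&` psi @^-1` (phi @` U).
    apply/seteqP; split=> [_ [y Uy <-]|z [Vz [y Uy phyz]]].
      by split; [apply: fUV; exists y|exists y => //; rewrite fE].
    by exists y => //; rewrite -gphi // phyz gK.
  have [_ cpsi _] := hpsi; rewrite continuous_open_subspace // in cpsi.
  exact: (proj1 (continuous_inP _ oV) cpsi).
apply: homeo_on_eq gphi _; rewrite fUE.
exact: homeo_on_comp hphi (homeo_on_sub phU hg).
Qed.

(** Charts make every point a limit of other ones. *)
Lemma nbhs_infinite (x : X) W : branched_covering h f -> nbhs x W ->
  infinite_set W.
Proof.
move=> [_ /(_ x)[d [_ [U [V [phi [psi [[chU _] _ _ _]]]]]]]] xW fW.
apply: (rV_nbhs_infinite (chart_nbhs chU xW)); apply: finite_image.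
exact: finite_setIr.
Qed.

End LocalDegree.

Section SubdivisionMapLocalHomeo.
Variables (R : realType) (X : topologicalType) (Rl : subdivision_rule R X).
Variable (h : X -> 'rV[R]_3).
Hypothesis hX : hausdorff_space X.
Hypothesis fB : branched_covering h (subdivision_map Rl).

Local Notation f := (subdivision_map Rl).
Local Notation C k := (subdivision Rl k).

(** A cell can have x in its closure without containing x only if its dimension
    is larger than n; the closures of the other cells form a closed set, as
    there are finitely many of them. *)
Lemma subdivision_star k n e x : C k n e -> e x ->
  \forall y \near x, forall m e', C k m e' -> e' y -> e' = e \/ (n < m)%N.
Proof.
move=> ne ex.
pose bad := \bigcup_(m in `I_n.+1) (C k m `\ e).
have fbad : finite_set bad.
  by apply: bigcup_finite => // m _; apply: finite_setD; exact: subdivision_finite.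
have cl : closed (\bigcup_(e' in bad) closure e').
  by apply: closed_bigcup => // e' _; exact: closed_closure.
have xN : (~` \bigcup_(e' in bad) closure e') x.
  move=> [e' [m /= mn [me' /= e'e]]] /(subdivision_closure hX me')[e'x|].
    by have [_ /e'e] := subdivision_unique me' ne e'x ex.
  move=> [m' [e2 [m'm m'e2 e2x]]].
  by have [m'n _] := subdivision_unique m'e2 ne e2x ex; move: mn; rewrite -m'n ltnNge m'm.
have := open_nbhs_nbhs (conj (closed_openC cl) xN); apply: filterS => y yN m e' me' e'y.
have [?|e'e] := pselect (e' = e); [by left|right].
rewrite ltnNge; apply/negP => mn; apply: yN.
by exists e'; [exists m => //; split|exact: subset_closure].
Qed.

(** The degree is one at the points of an edge e.  Near x the points with image
    in f @` e belong to e, where f is injective, whereas a larger degree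
    would give another such point with the same image. *)
Lemma subdivision_map_local_homeo k e x :
  C k.+1 1 e -> e x -> local_homeo_at f x.
Proof.
move=> e1 ex; have [_ /(_ x)[d dx]] := fB.
case: (eqVneq d 1%N) dx => [->|d_neq1] dx; first exact: degree1_local_homeo dx.
have d1 : (1 < d)%N by case: dx => d0 _; lia.
have := degree_gt1_not_inj dx d1 (subdivision_star e1 ex).
have [phi hphi] := subdivision_oball e1.
have [g [hg ge phie gK phiK]] := homeo_on_inverse hphi.
have gx := ge _ ex.
move=> N; have {}N : nbhs (phi (g x)) (fun y => y <> x -> exists y',
   [/\ forall m e', C k.+1 m e' -> e' y' -> e' = e \/ (1 < m)%N, y' <> y & f y' = f y])
  by rewrite phiK.
have [_ /within_continuousP cphi _] := hphi.
have [P gP PN] := cphi _ gx _ N.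
have gPo : nbhs (g x) (oball 1 `&` P).
  by apply: filterI => //; apply: open_nbhs_nbhs; split=> //; exact: open_oball.
have [q [[q1 Pq] qgx]] := infinite_setN0
  (infinite_setD (rV_nbhs_infinite gPo) (finite_set1 (g x))).
have qx : phi q <> x by move=> qx; apply: qgx; rewrite -qx gK.
(* phi q and y' are different points with the same image, and both are in e *)
have [y' [y'N y'q fy']] := PN _ Pq q1 qx.
have [e1' [[_ fI _] _ _]] := subdivision_homeo e1.
have [m [e' [me' e'y']]] := subdivision_cover Rl k.+1 y'.
have [me'f _] := subdivision_homeo me'.
have fy'e : (f @` e) (f y') by rewrite fy'; apply: imageP; exact: phie.
have [m1 _] := subdivision_unique me'f e1' (imageP f e'y') fy'e.
have [e'e|] := y'N _ _ me' e'y'; last by rewrite m1.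
case: y'q; apply: fI => //; rewrite inE; [by rewrite -e'e|exact: phie].
Qed.

Lemma iter_subdivision_map_local_homeo k e x :
  C k 1 e -> e x -> local_homeo_at (iter k f) x.
Proof.
elim: k e x => [|k IH] e x e1 ex; first exact: local_homeo_id.
have -> : iter k.+1 f = iter k f \o f by apply/funext => y; rewrite iterSr.
have [fe1 _] := subdivision_homeo e1.
apply: local_homeo_comp (subdivision_map_local_homeo e1 ex) _.
by apply: IH fe1 _; exists x.
Qed.

End SubdivisionMapLocalHomeo.

(** * Tiles and edges *)
Lemma connected_star (T : topologicalType) (A : set T) (a : T) :
  (forall b, A b -> exists S, [/\ connected S, S `<=` A, S a & S b]) ->
  connected A.
Proof.
move=> AS; have [A0|/set0P[b0 Ab0]] := eqVneq A set0.
  by rewrite A0; exact: connected0.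
have -> : A = \bigcup_(S in [set S | [/\ connected S, S `<=` A & S a]]) S.
  apply/seteqP; split=> [b /AS[S [cS SA Sa Sb]]|b [S [_ SA _] /SA]] //.
  by exists S.
apply: bigcup_connected => [|S []//].
by exists a => S [].
Qed.

Section Convexity.
Variable R : realType.

Definition convex_comb n (s : R) (a b : 'rV[R]_n) := (1 - s) *: a + s *: b.

Lemma convex_comb_connected n (a b : 'rV[R]_n) :
  connected ((fun s => convex_comb s a b) @` [set s | 0 <= s <= 1]).
Proof.
apply: connected_continuous_connected.
  have -> : [set s : R | 0 <= s <= 1] = `[0, 1]%classic.
    by apply/seteqP; split=> s; rewrite /= in_itv.
  exact: segment_connected.
apply: continuous_subspaceT => s; rewrite /convex_comb.
apply: cvgD; last by apply: cvgZl; exact: cvg_id.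
by apply: cvgZl; apply: cvgB; [exact: cvg_cst|exact: cvg_id].
Qed.

Lemma convex_connected n (A : set 'rV[R]_n) :
  (forall a b s, A a -> A b -> 0 <= s <= 1 -> A (convex_comb s a b)) ->
  connected A.
Proof.
move=> cA; have [A0|/set0P[a Aa]] := eqVneq A set0.
  by rewrite A0; exact: connected0.
apply: (@connected_star _ _ a) => b Ab.
exists ((fun s => convex_comb s a b) @` [set s | 0 <= s <= 1]); split.
- exact: convex_comb_connected.
- by move=> _ [s /= s01 <-]; exact: cA.
- by exists 0; rewrite /= ?lexx ?ler01 // /convex_comb subr0 scale1r scale0r addr0.
- by exists 1; rewrite /= ?lexx ?ler01 // /convex_comb subrr scale1r scale0r add0r.
Qed.

Lemma sqnorm_convex n (a b : 'rV[R]_n) s : 0 <= s <= 1 ->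
  sqnorm (convex_comb s a b) <= (1 - s) * sqnorm a + s * sqnorm b.
Proof.
move=> /andP[s0 s1]; rewrite /sqnorm !mulr_sumr -big_split /=.
apply: ler_sum => i _; rewrite /convex_comb !mxE -subr_ge0.
rewrite (_ : _ - _ = s * (1 - s) * (a 0 i - b 0 i) ^+ 2); last by ring.
by rewrite mulr_ge0 ?sqr_ge0 // mulr_ge0 // subr_ge0.
Qed.

Lemma oball_convex n (a b : 'rV[R]_n) s : oball n a -> oball n b ->
  0 <= s <= 1 -> oball n (convex_comb s a b).
Proof.
rewrite /oball /= => a1 b1 s01; apply: le_lt_trans (sqnorm_convex _ _ s01) _.
move: s01 => /andP[s0 s1]; have [->|s_neq0] := eqVneq s 0; first by lra.
have : s * sqnorm b < s * 1 by rewrite ltr_pM2l // lt_def s_neq0.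
have : (1 - s) * sqnorm a <= (1 - s) * 1 by rewrite ler_wpM2l ?subr_ge0 // ltW.
by lra.
Qed.

Lemma ball_convex n (p a b : 'rV[R]_n) r s : ball p r a -> ball p r b ->
  0 <= s <= 1 -> ball p r (convex_comb s a b).
Proof.
rewrite -ball_normE /ball_ /= => a1 b1 /andP[s0 s1].
have -> : p - convex_comb s a b = (1 - s) *: (p - a) + s *: (p - b).
  rewrite /convex_comb !scalerBr !scalerBl !scale1r opprD opprB.
  by apply/rowP => i; rewrite !mxE; ring.
apply: le_lt_trans (ler_normD _ _) _; rewrite !normrZ (ger0_norm s0).
rewrite (ger0_norm (_ : 0 <= 1 - s)) ?subr_ge0 //.
have [->|s_neq0] := eqVneq s 0; first by lra.
have : s * `|p - b| < s * r by rewrite ltr_pM2l // lt_def s_neq0.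
have : (1 - s) * `|p - a| <= (1 - s) * r by rewrite ler_wpM2l ?subr_ge0 // ltW.
by lra.
Qed.

Lemma cdisk_closure_oball n (q : 'rV[R]_n) : cdisk n q -> closure (oball n) q.
Proof.
move=> q1 W qW.
have : {for 1, continuous (fun s : R => s *: q)}.
  by apply: cvgZl; exact: cvg_id.
move=> /(_ W); rewrite /= scale1r => /(_ qW) /nbhs_ballP[r /= r0 rW].
pose s := 1 - Num.min (r / 2) (1 / 2).
have m0 : 0 < Num.min (r / 2) (1 / 2) by rewrite lt_min; apply/andP; split; lra.
have mr : Num.min (r / 2) (1 / 2) <= r / 2 by rewrite ge_min lexx.
have m1 : Num.min (r / 2) (1 / 2) <= 1 / 2 by rewrite ge_min lexx orbT.
exists (s *: q); split; last first.
  by apply: rW; rewrite -ball_normE /ball_ /= /s opprB addrC subrK gtr0_norm //; lra.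
rewrite /oball /= /sqnorm (_ : \sum_i _ = s ^+ 2 * sqnorm q).
  have : sqnorm q <= 1 by [].
  have s2 : s ^+ 2 < 1 by rewrite /s; nra.
  have : 0 <= s ^+ 2 by exact: sqr_ge0.
  by move=> ? ?; nra.
by rewrite mulr_sumr; apply: eq_bigr => i _; rewrite mxE exprMn.
Qed.

End Convexity.

Section TileTypes.
Variables (R : realType) (X : topologicalType) (C : nat -> set (set X)).
Variables (c : set X) (t : nat -> set (set 'rV[R]_2)) (psi : 'rV[R]_2 -> X).
Hypothesis hX : hausdorff_space X.
Hypothesis cC : cell_structure R setT C.
Hypothesis c2 : C 2 c.
Hypothesis ct : tile_type C c t psi.

Lemma tile_type_cell p m e : cdisk 2 p -> C m e -> e (psi p) ->
  exists a, [/\ t m a, a p & psi @` a = e].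
Proof.
move=> p1 me ep; have [tC _ _ tpsi] := ct.
have [n [a [na ap]]] := cell_cover tC p1.
have [ne _] := tpsi _ _ na.
have [nm pe] := cell_unique cC ne me (imageP psi ap) ep.
by exists a; rewrite -nm -pe.
Qed.

(** The 1-skeleton of the tile type is the circle, so the points of the open disk
    lie in cells of dimension two, and those of the circle do not. *)
Lemma tile_type_oball q : cdisk 2 q -> oball 2 q <-> c (psi q).
Proof.
move=> q1; have [tC [tsk _] [_ pc] tpsi] := ct; split=> [q2|cq].
  have [m [a [ma aq]]] := cell_cover tC q1.
  have [mpa _] := tpsi _ _ ma.
  have clq : closure c (psi q) by rewrite -pc; exists q.
  case: (cell_closure hX cC c2 clq) => // -[n [e [n2 ne eq]]].
  have [a' [na' a'q _]] := tile_type_cell q1 ne eq.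
  suff : usphere 2 q by rewrite /usphere /= => sq; move: q2; rewrite /oball /= sq ltxx.
  by rewrite -tsk; exists n, a'.
have [a [a2 aq _]] := tile_type_cell q1 c2 cq.
move: q1; rewrite cdiskE => -[//|]; rewrite -tsk => -[n [e [n2 ne eq]]].
by have [n2' _] := cell_unique tC ne a2 eq aq; rewrite n2' in n2.
Qed.

End TileTypes.

Section TilesAndEdges.
Variables (R : realType) (X : topologicalType) (Rl : subdivision_rule R X).
Variable (h : X -> 'rV[R]_3).
Hypothesis hX : hausdorff_space X.
Hypothesis fB : branched_covering h (subdivision_map Rl).

Local Notation f := (subdivision_map Rl).
Local Notation C k := (subdivision Rl k).

Lemma iter_subdivision_map_continuous k : continuous (iter k f).
Proof.
elim: k => [|k IH] x; first exact: cvg_id.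
exact: (continuous_comp (IH x) (@subdivision_map_continuous _ _ Rl _)).
Qed.

(** Outside the 1-skeleton a 2-cell is relatively closed, and relatively open
    because the finitely many other 2-cells are relatively closed too. *)
Lemma connected_in_2cell k K z d : connected K ->
  (forall y, K y -> exists2 d', C k 2 d' & d' y) ->
  K z -> C k 2 d -> d z -> K `<=` d.
Proof.
move=> cK K2 Kz d2 dz.
have clo d' y : C k 2 d' -> closure d' y -> K y -> d' y.
  move=> d'2 /(subdivision_closure hX d'2)[//|[m [e [m2 me ey]]]] /K2[d1 d12 d1y].
  by have [m2' _] := subdivision_unique me d12 ey d1y; rewrite m2' in m2.
pose F := \bigcup_(d' in C k 2 `\ d) closure d'.
have cF : closed F.
  apply: closed_bigcup => [|d' _]; last exact: closed_closure.
  by apply: finite_setD; exact: subdivision_finite.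
suff <- : K `&` d = K by move=> y [].
apply: cK; first by exists z.
- exists (~` F); first exact: closed_openC.
  apply/seteqP; split=> y [Ky].
    move=> dy; split=> // -[d' [d'2 /= d'd] d'y].
    by apply: d'd; have [_ ->] := subdivision_unique d'2 d2 (clo _ _ d'2 d'y Ky) dy.
  move=> nFy; split=> //; have [d' d'2 d'y] := K2 _ Ky.
  apply: contrapT => ndy; apply: nFy; exists d'; last exact: subset_closure.
  by split=> // d'd; apply: ndy; rewrite -d'd.
- exists (closure d); first exact: closed_closure.
  apply/seteqP; split=> y [Ky dy]; split=> //; first exact: subset_closure.
  exact: clo.
Qed.

(** A point x of an edge e is locally a copy of f^k x.  A half disk at a
    boundary point p of a tile type over f^k x therefore lifts to a half disk
    at x; it is connected, so it lies in a single 2-cell, and that 2-cell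
    accumulates at all points of e near x. *)
Lemma half_disk_lift k e x c t (psi : 'rV[R]_2 -> X) p :
  C k 1 e -> e x -> C 0 2 c -> tile_type (C 0) c t psi ->
  cdisk 2 p -> psi p = iter k f x ->
  exists d, [/\ C k 2 d,
    \forall y \near x, e y -> closure d y &
    exists N U, [/\ nbhs p N, nbhs x U &
      forall y q, U y -> N q -> oball 2 q -> psi q = iter k f y -> d y]].
Proof.
set g := iter k f => e1 ex c2 ct p1 pgx.
have C0 : cell_structure R setT (C 0) := complex0_cell Rl.
have [U [oU Ux ogU hU]] := iter_subdivision_map_local_homeo hX fB e1 ex.
rewrite -/g in ogU hU.
have [g' [hg' g'U gU g'K gK]] := homeo_on_inverse hU.
have [_ cg' _] := hg'.
have [tC _ [cpsi pc] tpsi] := ct.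
have xgU : nbhs (psi p) (g @` U).
  by rewrite pgx; apply: open_nbhs_nbhs; split=> //; exists x.
have [N0 pN0 N0U] := (within_continuousP _ _).1 cpsi _ p1 _ xgU.
have [r /= r0 rN0] := (nbhs_ballP _ _).1 pN0.
have pr q : ball p r q -> cdisk 2 q -> (g @` U) (psi q).
  by move=> /rN0; exact: N0U.
pose H := oball 2 `&` ball p r.
pose lift q := g' (psi q).
have cH : connected H.
  apply: convex_connected => a b s [a1 ar] [b1 br] s01.
  by split; [exact: oball_convex|exact: ball_convex].
have clift : {within cdisk 2 `&` ball p r, continuous lift}.
  apply: (continuous_comp_within (B := g @` U)) cg'.
    by move=> q [q1 qr]; exact: pr.
  by apply: continuous_subspaceW cpsi => q [].
have cK : connected (lift @` H).
  apply: connected_continuous_connected cH _.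
  by apply: continuous_subspaceW clift => q [q1 qr]; split=> //; exact: oball_cdisk.
have K2 y : (lift @` H) y -> exists2 d', C k 2 d' & d' y.
  move=> [q [q1 qr] <-]; have [n [d' [nd' d'q]]] := subdivision_cover Rl k (lift q).
  have [ngd' _] := subdivision_iter_homeo nd'; rewrite -/g in ngd'.
  have cq : c (psi q) by apply/(tile_type_oball hX C0 c2 ct); [exact: oball_cdisk|].
  have gd'q : (g @` d') (psi q).
    exists (lift q) => //; rewrite /lift gK //; apply: pr => //; exact: oball_cdisk.
  by have [n2 _] := cell_unique C0 ngd' c2 gd'q cq; exists d' => //; rewrite -n2.
(* the half disk is dense in the part of the closed disk near p *)
have Hne q : cdisk 2 q -> ball p r q -> forall W, nbhs q W -> exists2 q', H q' & W q'.
  move=> q1 qr W qW; have qr' : nbhs q (ball p r) by apply: open_nbhs_nbhs; split => //; exact: ball_open.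
  have [q' [q'1 [q'W q'r]]] := cdisk_closure_oball q1 (filterI qW qr').
  by exists q'.
have [q0 Hq0 _] := Hne _ p1 (ballxx p r0) setT filterT.
have K0 : (lift @` H) (lift q0) by exists q0.
have [d d2 dq0] := K2 _ K0.
have Kd := connected_in_2cell cK K2 K0 d2 dq0.
have Uxn : nbhs x U by exact: open_nbhs_nbhs.
exists d; split=> //; last first.
  exists (ball p r), U; split=> //; first exact: nbhsx_ballx.
  move=> y q Uy qr q1 qy; apply: Kd; exists q => //.
  by rewrite /lift qy g'K.
(* Near x, the edge e corresponds to the edge a of the tile type that
   contains p, and the half disk accumulates at the points of a near p. *)
have [ge1 hge] := subdivision_iter_homeo e1; rewrite -/g in ge1 hge.
have egx : (g @` e) (psi p) by rewrite pgx; exists x.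
have [a [a1 ap pa]] := tile_type_cell C0 ct p1 ge1 egx.
have ad : a `<=` cdisk 2.
  by case: tC => _ <- _ _ q aq; exists 1%N => //; exists a.
have [_ ha] := tpsi _ _ a1.
have [psi' [hpsi' psi'a _ psi'K psiK]] := homeo_on_inverse ha.
have [_ cge _] := hge; have [_ cpsi' _] := hpsi'.
rewrite pa in cpsi' psi'a psiK.
have cpg : {within e, continuous (psi' \o g)}.
  apply: (continuous_comp_within (B := g @` e)) cge cpsi'.
  by move=> y ey; exists y.
have pgxr : nbhs ((psi' \o g) x) (ball p r).
  by rewrite /= -pgx psi'K //; exact: nbhsx_ballx.
have [V xV VH] := (within_continuousP _ _).1 cpg _ ex _ pgxr.
apply: filterS2 xV Uxn => y Vy Uy ey W yW.
have qr := VH _ Vy ey; set q := (psi' \o g) y in qr.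
have gey : (g @` e) (g y) by exists y.
have q1 : cdisk 2 q by apply: ad; exact: psi'a.
have liftq : lift q = y by rewrite /lift /q /= psiK // g'K.
have lW : nbhs (lift q) W by rewrite liftq.
have [N qN NW] := (within_continuousP _ _).1 clift _ (conj q1 qr) _ lW.
have [q' Hq' Nq'] := Hne _ q1 qr _ qN.
exists (lift q'); split; first by apply: Kd; exists q'.
by apply: NW => //; case: Hq' => q'1 ?; split=> //; exact: oball_cdisk.
Qed.

(** Points y of a 2-cell d near x have preimages in the closed disk, which
    accumulate at some boundary point p of the tile type; the half disk at p
    then lifts into d itself. *)
Lemma edge_near_closure k d e x : C k 2 d -> C k 1 e -> closure d x -> e x ->
  \forall y \near x, e y -> closure d y.
Proof.
move=> d2 e1 dx ex; set g := iter k f.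
have C0 : cell_structure R setT (C 0) := complex0_cell Rl.
have [gd2 _] := subdivision_iter_homeo d2; rewrite -/g in gd2.
have [t [psi ct]] := subdivision_rule_tile_type gd2.
have [_ _ [cpsi pc] _] := ct.
have /choice[s sP] y : exists q, d y -> oball 2 q /\ psi q = g y.
  have [dy|] := pselect (d y); last by exists 0.
  have : closure (g @` d) (g y) by apply: subset_closure; exists y.
  rewrite -pc => -[q q1 qy]; exists q => _; split=> //.
  by apply/(tile_type_oball hX C0 gd2 ct) => //; rewrite qy; exists y.
(* the filter of the preimages s y of the points y of d near x *)
pose F := s @ within d (nbhs x).
have FF : ProperFilter F := fmap_proper_filter _ (within_nbhs_proper dx).
have F1 : F (cdisk 2).
  suff : nbhs x [set y | d y -> cdisk 2 (s y)] by [].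
  apply: filterE => y dy.
  by apply: oball_cdisk; case: (sP y dy).
have [p [p1 clp]] := compact_cdisk FF F1.
have Fd W : nbhs x W -> F (s @` (d `&` W)).
  move=> xW; suff : nbhs x [set y | d y -> (s @` (d `&` W)) (s y)] by [].
  by apply: filterS xW => y Wy dy; exists y.
have pgx : psi p = g x.
  apply: hX => A B pA gxB.
  have [N pN NA] := (within_continuousP _ _).1 cpsi _ p1 _ pA.
  have xB := iter_subdivision_map_continuous gxB.
  have [q [[y [dy By] <-] Nq]] := clp _ _ (Fd _ xB) pN.
  have [sy1 sy] := sP _ dy; exists (g y); split=> //.
  by rewrite -sy; apply: NA => //; exact: oball_cdisk.
have [d' [d'2 ed' [N [U [pN xU NU]]]]] := half_disk_lift e1 ex gd2 ct p1 pgx.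
have [q [[y [dy Uy] <-] Nq]] := clp _ _ (Fd _ xU) pN.
have [sy1 sy] := sP _ dy.
have d'y := NU _ _ Uy Nq sy1 sy.
by have [_ ->] := subdivision_unique d2 d'2 dy d'y.
Qed.

(** The points of e in the closure of d form a closed and open subset of e. *)
Lemma edge_sub_closure k d e x : C k 2 d -> C k 1 e -> closure d x -> e x ->
  e `<=` closure d.
Proof.
move=> d2 e1 dx ex.
have ce : connected e.
  have [phi hphi] := subdivision_oball e1; rewrite -(homeo_on_image hphi).
  apply: connected_continuous_connected; last by case: hphi.
  by apply: convex_connected; exact: oball_convex.
suff <- : e `&` closure d = e by move=> y [].
apply: ce; first by exists x.
- exists [set y | e y -> closure d y]°; first exact: open_interior.
  apply/seteqP; split=> y [ey].
    by move=> dy; split=> //; exact: edge_near_closure d2 e1 dy ey.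
  by move=> /interior_subset /(_ ey).
- by exists (closure d) => //; exact: closed_closure.
Qed.

Lemma zero_cell_finite k e : C k 0 e -> finite_set e.
Proof.
move=> /subdivision_oball[phi /homeo_on_image <-].
apply: finite_image; apply: (sub_finite_set (B := [set 0])); last exact: finite_set1.
by move=> v _; apply/rowP => -[].
Qed.

Lemma vertices_finite k : finite_set (\bigcup_(e in C k 0) e).
Proof.
apply: bigcup_finite => [|e]; first exact: subdivision_finite.
exact: zero_cell_finite.
Qed.

(** At level k the image under f^k of an edge point lies in a tile of level 0, and a half
    disk of its tile type lifts.  Vertices are limits of other points, because
    there are finitely many of them. *)
Lemma tiles_cover k x : exists2 d, C k 2 d & closure d x.
Proof.
have edge_case y e : C k 1 e -> e y -> exists2 d, C k 2 d & closure d y.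
  move=> e1 ey.
  have [_ [c c2 <-] cy] : (\bigcup_(t in tiles (C 0)) t) (iter k f y).
    by rewrite (complex0_tiles Rl).
  have [t [psi ct]] := subdivision_rule_tile_type c2.
  have [_ _ [_ pc] _] := ct; move: cy; rewrite -pc => -[p p1 py].
  have [d [d2 /nbhs_singleton ed _]] := half_disk_lift e1 ey c2 ct p1 py.
  by exists d => //; exact: ed.
apply: contrapT => xN.
pose Z := \bigcup_(d in C k 2) closure d.
have cZ : closed Z.
  apply: closed_bigcup => [|d _]; [exact: subdivision_finite|exact: closed_closure].
have xZ : nbhs x (~` Z).
  apply: open_nbhs_nbhs; split; first exact: closed_openC.
  by move=> [d d2 dx]; apply: xN; exists d.
apply: (nbhs_infinite fB xZ); apply: sub_finite_set (vertices_finite k).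
move=> y yZ; have [n [e [ne ey]]] := subdivision_cover Rl k y.
have n2 := subdivision_dim ne.
case: n => [|[|[|//]]] in ne n2; first by exists e.
- by have [d d2 dy] := edge_case _ _ ne ey; case: yZ; exists d.
- by case: yZ; exists e => //; exact: subset_closure.
Qed.

End TilesAndEdges.

(** * The sphere without finitely many points *)
Section PlaneTopology.
Variable R : realType.

Lemma reals_infinite : infinite_set [set: R].
Proof.
move=> fR; apply: infinite_nat.
have -> : [set: nat] = (fun n : nat => n%:R : R) @^-1` setT by [].
by apply: finite_preimage => // m n _ _ /eqP; rewrite eqr_nat => /eqP.
Qed.

(** A continuous injection of the open disk into the line would take different
    values at antipodal points of a circle, against the intermediate value
    theorem for the difference of the two values. *)
Lemma no_disk_in_interval (F : 'rV[R]_2 -> 'rV[R]_1) :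
  {within oball 2, continuous F} -> ~ set_inj (oball 2) F.
Proof.
move=> cF iF.
pose P (a : R) : 'rV[R]_2 := \row_(i < 2) (if i == 0 then cos a / 2 else sin a / 2).
have P1 a : oball 2 (P a).
  rewrite /oball /= /sqnorm !big_ord_recl big_ord0 !mxE /=.
  rewrite addr0 !expr_div_n -mulrDl cos2Dsin2; lra.
have cP : continuous P.
  move=> a; apply: rV_continuous_at => i; have [->|->] := ord2P i.
    rewrite (_ : (fun _ => _) = (fun a => cos a / 2)).
      exact: (cvgM (@continuous_cos R a) (cvg_cst (2^-1 : R))).
    by apply/funext => b; rewrite mxE.
  rewrite (_ : (fun _ => _) = (fun a => sin a / 2)).
    exact: (cvgM (@continuous_sin R a) (cvg_cst (2^-1 : R))).
  by apply/funext => b; rewrite mxE.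
have PN a : P (a + pi) = - P a.
  by apply/rowP => i; rewrite !mxE; case: ifP => _; rewrite ?cosDpi ?sinDpi mulNr.
have cFP : continuous (fun a => F (P a) 0 0).
  move=> a; suff cFoP : {for a, continuous (F \o P)}.
    exact: (continuous_comp cFoP (@coord_continuous R 1 1 0 0 _)).
  move=> W FW; have [U PU UW] := proj1 (within_continuousP (oball 2) F) cF (P a) (P1 a) W FW.
  suff : nbhs a [set b | W (F (P b))] by [].
  apply: (@filterS _ _ _ [set b | U (P b)]); last exact: cP.
  by move=> b Ub; apply: UW => //; exact: P1.
pose G a := F (P a) 0 0 - F (P (a + pi)) 0 0.
have cG : continuous G.
  move=> a.
  have ca : {for a, continuous (fun b : R => b + pi)} := cvgD cvg_id (cvg_cst (pi : R)).
  have cH : {for a, continuous ((fun c => F (P c) 0 0) \o (fun b : R => b + pi))}.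
    by move=> W /(cFP (a + pi)) /ca.
  exact: (cvgB (cFP a) cH).
have Gpi : G pi = - G 0.
  rewrite /G add0r opprB; congr (_ - F _ 0 0).
  by rewrite PN -[pi in LHS]add0r PN opprK.
have [a _ Ga] : exists2 a, a \in `[0, pi] & G a = 0.
  apply: IVT; first exact: pi_ge0.
    exact: continuous_subspaceT.
  rewrite Gpi; have [G0|G0] := leP 0 (G 0).
    by rewrite ge_min le_max oppr_le0 G0 orbT.
  by rewrite ge_min le_max oppr_ge0 (ltW G0) orbT.
have Paa : P a = P (a + pi).
  apply: iF; rewrite ?inE //; apply/rowP => i; rewrite (ord1 i).
  by move/eqP: Ga; rewrite subr_eq0 => /eqP.
have Pa0 : P a = 0.
  apply/rowP => i; have := congr1 (fun v : 'rV_2 => v 0 i) Paa.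
  by rewrite PN !mxE; case: ifP => _; lra.
have := cos2Dsin2 a.
have := congr1 (fun v : 'rV_2 => v 0 0) Pa0; have := congr1 (fun v : 'rV_2 => v 0 1) Pa0.
rewrite !mxE /= => s0 c0.
have -> : cos a = 0 by lra.
have -> : sin a = 0 by lra.
by rewrite expr0n addr0 => /eqP; rewrite eq_sym oner_eq0.
Qed.

(** Two points of the plane are joined by infinitely many two-segment paths
    through their perpendicular bisector, and a further point lies on at most
    two of them. *)
Lemma plane_minus_finite_connected (F : set 'rV[R]_2) :
  finite_set F -> connected (~` F).
Proof.
move=> fF; have [->|/set0P[a aF]] := eqVneq (~` F) set0; first exact: connected0.
apply: (@connected_star _ _ a) => b bF.
have [ab|ab] := eqVneq a b.
  exists [set a]; split=> //; first exact: connected1.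
  by move=> _ ->.
pose u := b - a.
pose N := u 0 0 ^+ 2 + u 0 1 ^+ 2.
have N0 : N != 0.
  apply: contra_neq ab => N0.
  have u0 : u 0 0 = 0 by rewrite /N in N0; nra.
  have u1 : u 0 1 = 0 by rewrite /N in N0; nra.
  apply/rowP => i; move: u0 u1; rewrite !mxE; have [->|->] := ord2P i; lra.
(* the points of the perpendicular bisector *)
pose w s : 'rV[R]_2 := \row_(i < 2)
  (if i == 0 then (a 0 0 + b 0 0) / 2 - s * u 0 1 else (a 0 1 + b 0 1) / 2 + s * u 0 0).
(* the only s for which f can lie on the segment from p to w s, where c is
   1 for p = a and -1 for p = b *)
pose slope (p f : 'rV[R]_2) (c : R) :=
  ((f 0 1 - p 0 1) * u 0 0 - (f 0 0 - p 0 0) * u 0 1) /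
  (c * 2 * ((f 0 0 - p 0 0) * u 0 0 + (f 0 1 - p 0 1) * u 0 1)).
have bad p c f s t : (p = a /\ c = 1) \/ (p = b /\ c = -1) -> p <> f ->
    f = convex_comb t p (w s) -> s = slope p f c.
  move=> pc pf fE.
  have t0 : t != 0.
    by apply/eqP => t0; apply: pf; rewrite fE t0 /convex_comb subr0 scale1r scale0r addr0.
  have f0 : f 0 0 - p 0 0 = t * (c * u 0 0 / 2 - s * u 0 1).
    by rewrite fE !mxE /=; case: pc => -[-> ->]; field.
  have f1 : f 0 1 - p 0 1 = t * (c * u 0 1 / 2 + s * u 0 0).
    by rewrite fE !mxE /=; case: pc => -[-> ->]; field.
  have c2 : c * c = 1 by case: pc => -[_ ->]; ring.
  have num : (f 0 1 - p 0 1) * u 0 0 - (f 0 0 - p 0 0) * u 0 1 = s * (t * N).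
    by rewrite f0 f1 /N; ring.
  have den : c * 2 * ((f 0 0 - p 0 0) * u 0 0 + (f 0 1 - p 0 1) * u 0 1) = t * N.
    rewrite f0 f1 /N (_ : _ * _ = c * c * t * (u 0 0 ^+ 2 + u 0 1 ^+ 2)); last by field.
    by rewrite c2 mul1r.
  by rewrite /slope num den mulfK // mulf_neq0.
have fbad : finite_set ((fun f => slope a f 1) @` F `|` (fun f => slope b f (-1)) @` F).
  by rewrite finite_setU; split; exact: finite_image.
have [s [_ sN]] := infinite_setN0 (infinite_setD reals_infinite fbad).
pose seg (p q : 'rV[R]_2) := (fun t => convex_comb t p q) @` [set t | 0 <= t <= 1].
have seg0 p q : seg p q p.
  by exists 0; rewrite /= ?lexx ?ler01 // /convex_comb subr0 scale1r scale0r addr0.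
have seg1 p q : seg p q q.
  by exists 1; rewrite /= ?lexx ?ler01 // /convex_comb subrr scale1r scale0r add0r.
exists (seg a (w s) `|` seg b (w s)); split.
- by apply: connectedU; [exists (w s)|exact: convex_comb_connected|exact: convex_comb_connected].
- move=> _ [] [t _ <-] Ff; apply: sN; [left|right].
    by exists (convex_comb t a (w s)) => //; apply/esym/(bad _ _ _ s t) => //;
      [left|move=> af; apply: aF; rewrite af].
  by exists (convex_comb t b (w s)) => //; apply/esym/(bad _ _ _ s t) => //;
    [right|move=> bf; apply: bF; rewrite bf].
- by left.
- by right.
Qed.

End PlaneTopology.

Section StereographicProjection.
Variable R : realType.

Let i0 : 'I_3 := ord0.
Let i1 : 'I_3 := lift ord0 ord0.
Let i2 : 'I_3 := lift ord0 (lift ord0 ord0).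

Lemma ord3P (i : 'I_3) : [\/ i = i0, i = i1 | i = i2].
Proof.
by case: i => [[|[|[|//]]] lt]; [constructor 1|constructor 2|constructor 3]; exact: val_inj.
Qed.

Lemma sqnorm3 (x : 'rV[R]_3) : sqnorm x = x 0 i0 ^+ 2 + x 0 i1 ^+ 2 + x 0 i2 ^+ 2.
Proof. by rewrite /sqnorm !big_ord_recl big_ord0 addr0 addrA. Qed.

(** inverse of the stereographic projection from the north pole *)
Definition stereo (v : 'rV[R]_2) : 'rV[R]_3 :=
  let N := v 0 0 ^+ 2 + v 0 1 ^+ 2 in
  \row_i (nth 0 [:: 2 * v 0 0; 2 * v 0 1; N - 1] i / (N + 1)).

Lemma sum_sqr_gt0 (a b : R) : 0 < a ^+ 2 + b ^+ 2 + 1.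
Proof. by rewrite ltr_wpDl ?ltr01 // addr_ge0 // sqr_ge0. Qed.

Lemma stereo_sphere v : usphere 3 (stereo v).
Proof.
rewrite /usphere /= sqnorm3 !mxE /=.
by field; rewrite lt0r_neq0 // sum_sqr_gt0.
Qed.

Lemma stereo_height v : 1 - stereo v 0 i2 = 2 / (v 0 0 ^+ 2 + v 0 1 ^+ 2 + 1).
Proof. by rewrite !mxE /=; field; rewrite lt0r_neq0 // sum_sqr_gt0. Qed.

Lemma stereo_inj : injective stereo.
Proof.
move=> u v uv; have := stereo_height u; rewrite uv stereo_height.
move=> /(mulfI _)-/(_ _)/invr_inj; rewrite pnatr_eq0 => /(_ isT) N.
have pos := sum_sqr_gt0 (v 0 0) (v 0 1).
apply/rowP => i.
have := congr1 (fun x : 'rV_3 => x 0 i0) uv; have := congr1 (fun x : 'rV_3 => x 0 i1) uv.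
rewrite !mxE /= -N => /(mulIf _)-/(_ _)/(mulfI _) E1 /(mulIf _)-/(_ _)/(mulfI _) E0.
have nz : (v 0 0 ^+ 2 + v 0 1 ^+ 2 + 1)^-1 != 0 by rewrite invr_eq0 lt0r_neq0.
have two : (2 : R) != 0 by rewrite pnatr_eq0.
by have [->|->] := ord2P i; [apply: E0|apply: E1]; rewrite // N.
Qed.

Lemma stereo_surj (x : 'rV[R]_3) : usphere 3 x -> x 0 i2 != 1 -> exists v, stereo v = x.
Proof.
rewrite /usphere /= sqnorm3 => x1 x2.
have d0 : 1 - x 0 i2 != 0 by rewrite subr_eq0 eq_sym.
exists (\row_(i < 2) ((if i == 0 then x 0 i0 else x 0 i1) / (1 - x 0 i2))).
have E : (x 0 i0 / (1 - x 0 i2)) ^+ 2 + (x 0 i1 / (1 - x 0 i2)) ^+ 2 =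
         (1 + x 0 i2) / (1 - x 0 i2).
  apply: (@mulIf _ ((1 - x 0 i2) ^+ 2)); first by rewrite expf_neq0.
  rewrite mulrDl !expr_div_n !mulfVK ?expf_neq0 //.
  rewrite expr2 mulrA mulfVK //.
  by transitivity (1 - x 0 i2 ^+ 2); [rewrite -x1; ring|ring].
apply/rowP => i; have [->|->|->] := ord3P i; rewrite !mxE /= E; field;
  rewrite d0 /= (_ : _ + _ = 2) ?pnatr_eq0 //; ring.
Qed.

Lemma stereo_continuous : continuous stereo.
Proof.
move=> v; apply: rV_continuous_at => i.
have c0 : {for v, continuous (fun y : 'rV[R]_2 => y 0 0)} by exact: coord_continuous.
have c1 : {for v, continuous (fun y : 'rV[R]_2 => y 0 1)} by exact: coord_continuous.
have cM (f g : 'rV[R]_2 -> R) : {for v, continuous f} -> {for v, continuous g} ->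
    {for v, continuous (fun y => f y * g y)} by move=> cf cg; exact: (cvgM cf cg).
have cN : {for v, continuous (fun y : 'rV[R]_2 => y 0 0 * y 0 0 + y 0 1 * y 0 1)}.
  exact: (cvgD (cM _ _ c0 c0) (cM _ _ c1 c1)).
have cV : {for v, continuous (fun y : 'rV[R]_2 => (y 0 0 * y 0 0 + y 0 1 * y 0 1 + 1)^-1)}.
  apply: (cvgV _ (cvgD cN (cvg_cst (1 : R)))).
  by rewrite -!expr2 lt0r_neq0 // sum_sqr_gt0.
rewrite (_ : (fun y => _) = (fun y : 'rV[R]_2 =>
  nth 0 [:: 2 * y 0 0; 2 * y 0 1; y 0 0 * y 0 0 + y 0 1 * y 0 1 - 1] i *
  (y 0 0 * y 0 0 + y 0 1 * y 0 1 + 1)^-1)); last first.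
  by apply/funext => y; rewrite mxE !expr2.
have [->|->|->] := ord3P i; apply: (cM _ _ _ cV) => /=.
- exact: (cM (fun=> 2) (fun y => y 0 0) (@cst_continuous _ _ _ v) c0).
- exact: (cM (fun=> 2) (fun y => y 0 1) (@cst_continuous _ _ _ v) c1).
- exact: (cvgB cN (cvg_cst (1 : R))).
Qed.

(** The pole of the stereographic projection is removed as well, so that what
    remains is a continuous image of the plane without finitely many points. *)
Lemma sphere_minus_finite_connected (X : topologicalType) (h : X -> 'rV[R]_3)
    (V : set X) :
  homeo_on setT (usphere 3) h -> finite_set V ->
  exists W, [/\ finite_set W, V `<=` W & connected (~` W)].
Proof.
move=> hh fV; have [g [hg _ hS gK hK]] := homeo_on_inverse hh.
pose tau := g \o stereo.
have tau_inj : injective tau.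
  move=> u v /(congr1 h); rewrite /tau /= !hK; [exact: stereo_inj|exact: stereo_sphere|].
  exact: stereo_sphere.
have ctau : continuous tau.
  apply/continuous_subspace_setT; apply: continuous_comp_within; last first.
  - by case: hg => _ cg _; exact: cg.
  - by apply: continuous_subspaceT => v; exact: stereo_continuous.
  - by move=> v _; exact: stereo_sphere.
pose W := V `|` [set x | h x 0 i2 = 1].
have fW : finite_set W.
  rewrite finite_setU; split=> //; apply: (sub_finite_set (B := [set g (delta_mx 0 i2)])); last exact: finite_set1.
  move=> x /= x2; rewrite -(gK x) //; congr g.
  have := hS x I; rewrite /usphere /= sqnorm3 x2 => n1.
  have x0 : h x 0 i0 = 0 by nra.
  have x1 : h x 0 i1 = 0 by nra.
  by apply/rowP => i; have [->|->|->] := ord3P i; rewrite !mxE /= ?x0 ?x1 ?x2.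
exists W; split=> //; first by move=> x; left.
suff -> : ~` W = tau @` (~` (tau @^-1` V)).
  apply: connected_continuous_connected; last exact: continuous_subspaceT.
  by apply: plane_minus_finite_connected; apply: finite_preimage => // u v _ _; exact: tau_inj.
apply/seteqP; split=> [x xW|_ [v vV <-]].
  have [|v vx] := @stereo_surj (h x) (hS _ I).
    by apply/eqP => x2; apply: xW; right.
  have tx : tau v = x by rewrite /tau /= vx gK.
  by exists v => //; rewrite /preimage /= tx => Vx; apply: xW; left.
case=> [//|]; rewrite /= /tau /= hK; last exact: stereo_sphere.
move=> E; have := stereo_height v; rewrite E subrr => /esym/eqP.
by rewrite mulf_eq0 invr_eq0 pnatr_eq0 /= gt_eqF // sum_sqr_gt0.
Qed.

End StereographicProjection.

(** * The graph of the tiles of one level *)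
Lemma closure_sub_closure (T : topologicalType) (A B : set T) :
  A `<=` closure B -> closure A `<=` closure B.
Proof.
move=> AB x /(closureS AB); rewrite -(closure_id _).1 //; exact: closed_closure.
Qed.

Section TileGraph.
Variables (R : realType) (X : topologicalType) (Rl : subdivision_rule R X).
Variable (h : X -> 'rV[R]_3).
Hypothesis hh : homeo_on setT (usphere 3) h.
Hypothesis hX : hausdorff_space X.
Hypothesis fB : branched_covering h (subdivision_map Rl).

Local Notation f := (subdivision_map Rl).
Local Notation C k := (subdivision Rl k).

Lemma two_cell_infinite k d : C k 2 d -> infinite_set d.
Proof.
move=> /subdivision_oball[phi hphi] fd.
have [g [_ _ _ gK _]] := homeo_on_inverse hphi.
apply: (@oball_infinite R 1); apply: sub_finite_set (finite_image g fd).
move=> v v1; exists (phi v); last exact: gK.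
by rewrite -(homeo_on_image hphi); exists v.
Qed.

Lemma one_cell_infinite k d : C k 1 d -> infinite_set d.
Proof.
move=> /subdivision_oball[phi hphi] fd.
have [g [_ _ _ gK _]] := homeo_on_inverse hphi.
apply: (@oball_infinite R 0); apply: sub_finite_set (finite_image g fd).
move=> v v1; exists (phi v); last exact: gK.
by rewrite -(homeo_on_image hphi); exists v.
Qed.

(** A disk embeds neither in a point nor in an interval. *)
Lemma two_cell_parent k d : C k.+1 2 d -> exists2 d', C k 2 d' & d `<=` d'.
Proof.
move=> d2; have [m [e [me de]]] := subdivision_subdivides d2.
have m2 := subdivision_dim me.
case: m => [|[|[|//]]] in me m2; last by exists e.
  by case: (two_cell_infinite d2); exact: sub_finite_set de (zero_cell_finite me).
have [phi hphi] := subdivision_oball d2; have [psi hpsi] := subdivision_oball me.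
have [g [hg _ _ _ _]] := homeo_on_inverse hpsi.
have [[_ iF _] cF _] := homeo_on_comp hphi (homeo_on_sub de hg).
by case: (no_disk_in_interval cF iF).
Qed.

Definition edge_adjacent k c d := [/\ C k 2 c, C k 2 d, c <> d &
  exists2 e, C k 1 e & closure e `<=` closure c `&` closure d].

(** Away from finitely many points the sphere is connected, and there the
    tiles reachable from c and the other ones form two disjoint closed sets. *)
Lemma tile_graph_connected k c d : C k 2 c -> C k 2 d ->
  exists n, walk (edge_adjacent k) n c d.
Proof.
move=> c2 d2; pose E := edge_adjacent k.
have [W [fW VW cW]] := sphere_minus_finite_connected hh (vertices_finite Rl k).
pose P := [set d | C k 2 d /\ exists n, walk E n c d].
pose A := \bigcup_(d in P) closure d.
pose B := \bigcup_(d in C k 2 `\` P) closure d.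
have cA : closed A.
  apply: closed_bigcup => [|e _]; last exact: closed_closure.
  by apply: sub_finite_set (subdivision_finite Rl k 2) => e [].
have cB : closed B.
  apply: closed_bigcup => [|e _]; last exact: closed_closure.
  by apply: finite_setD; exact: subdivision_finite.
have same c1 d1 y : C k 2 c1 -> C k 2 d1 -> c1 y -> closure d1 y -> d1 = c1.
  move=> c12 d12 cy /(subdivision_closure hX d12)[dy|[m [e [m2 me ey]]]].
    by have [_ ->] := subdivision_unique d12 c12 dy cy.
  by have [m2' _] := subdivision_unique me c12 ey cy; rewrite m2' in m2.
have AB : (~` W) `&` A `&` B = set0.
  apply/seteqP; split=> // y [[yW [c1 [c12 [n Wc1]] c1y]] [d1 [d12 nPd1] d1y]].
  apply: nPd1; split=> //; have [m [e [me ey]]] := subdivision_cover Rl k y.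
  have m2 := subdivision_dim me; case: m => [|[|[|//]]] in me m2.
  - by case: yW; apply: VW; exists e.
  - have ce := edge_sub_closure hX fB c12 me c1y ey.
    have de := edge_sub_closure hX fB d12 me d1y ey.
    have [<-|cd] := pselect (c1 = d1); first by exists n.
    exists (n + 1)%N; apply: walk_cat Wc1 _; apply: walk1; split=> //.
    by exists e => // z ez; split; exact: closure_sub_closure ez.
  - by exists n; rewrite (same _ _ _ me d12 ey d1y) -(same _ _ _ me c12 ey c1y).
have cov y : A y \/ B y.
  have [e e2 ey] := tiles_cover hX fB k y.
  by have [Pe|nPe] := pselect (P e); [left|right]; exists e.
have ptW e : C k 2 e -> exists2 y, e y & (~` W) y.
  move=> e2; have [y [ey yW]] := infinite_setN0 (infinite_setD (two_cell_infinite e2) fW).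
  by exists y.
have WA : ~` W `&` A = ~` W.
  apply: cW.
  - have [y cy yW] := ptW _ c2; exists y; split=> //; exists c; last exact: subset_closure.
    by split=> //; exists 0%N; exact: walk0.
  - exists (~` B); first exact: closed_openC.
    apply/seteqP; split=> y [yW yA]; split=> //.
      by move=> yB; rewrite -[False]/(set0 y) -AB.
    by have [|/yA] := cov y.
  - by exists A.
have [y dy yW] := ptW _ d2.
have [d1 [d12 Pd1] d1y] : A y by move: yW; rewrite -WA => -[].
by rewrite -(same _ _ _ d2 d12 dy d1y).
Qed.

End TileGraph.

(** * Distances in graphs *)
Section GraphDistance.
Variables (R : realType) (V : Type) (E : V -> V -> Prop).

Lemma graph_dist_le L u v :
  (graph_dist R E u v <= L%:R%:E)%E <-> near_by E L u v.
Proof.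
split=> [le|[n nL W]]; last first.
  apply: (@le_trans _ _ n%:R%:E); last by rewrite lee_fin ler_nat.
  by apply: ereal_inf_lbound; exists n.
apply: contrapT => far; suff : (L.+1%:R%:E <= graph_dist R E u v)%E.
  by move=> /le_trans/(_ le); rewrite lee_fin ler_nat ltnn.
apply: le_ereal_inf_tmp => _ [n W <-]; rewrite lee_fin ler_nat ltnNge.
by apply/negP => nL; apply: far; exists n.
Qed.

Lemma graph_dist_nat u v : (exists n, walk E n u v) ->
  {n | graph_dist R E u v = n%:R%:E & walk E n u v}.
Proof.
move=> ex; apply/cid2.
have ex' : exists n, `[< walk E n u v >] by case: ex => n W; exists n; apply/asboolP.
case: (ex_minnP ex') => n /asboolP W nmin; exists n => //.
apply/eqP; rewrite eq_le; apply/andP; split.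
  by apply/graph_dist_le; exists n.
by apply: le_ereal_inf_tmp => _ [m Wm <-]; rewrite lee_fin ler_nat; exact/nmin/asboolP.
Qed.

Lemma graph_dist_iff (E' : V -> V -> Prop) u v :
  (forall n, walk E n u v <-> walk E' n u v) ->
  graph_dist R E u v = graph_dist R E' u v.
Proof.
by move=> EE; rewrite /graph_dist; congr (ereal_inf (_ @` _)); apply/seteqP;
  split=> n /= /EE.
Qed.

Hypothesis E_sym : forall u v, E u v -> E v u.
Variable d : V -> V -> nat.
Hypothesis d_dist : forall u v, graph_dist R E u v = (d u v)%:R%:E.
Hypothesis d_walk : forall u v, walk E (d u v) u v.

Lemma graph_dist_min n u v : walk E n u v -> (d u v <= n)%N.
Proof. by move=> W; rewrite -(ler_nat R) -lee_fin -d_dist; apply/graph_dist_le; exists n. Qed.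

Lemma graph_dist_triangle u v w : (d u w <= d u v + d v w)%N.
Proof. by apply: graph_dist_min; exact: walk_cat. Qed.

Lemma graph_dist_sym u v : d u v = d v u.
Proof.
by apply/eqP; rewrite eqn_leq; apply/andP; split; apply: graph_dist_min; exact: walk_sym.
Qed.

Lemma graph_point_end (p : graph_point R E) a : graph_point_ends p a ->
  0 <= a.2 /\ (d (src p) a.1 <= 1)%N.
Proof.
have /andP[x0 x1] := graph_point_pos p.
have dss : (d (src p) (src p) <= 1)%N by apply: leq_trans (graph_dist_min (walk0 _ _)) _.
case=> -> /=; first by [].
split; first by rewrite subr_ge0.
by case: (graph_point_edge p) => [st|[<- _]] //; apply: graph_dist_min; exact: walk1.
Qed.

(** A point of an edge is at distance at most 1 from the source of that edge. *)
Lemma point_dist_src (p q : graph_point R E) :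
  `|fine (point_dist p q) - (d (src p) (src q))%:R| <= 2.
Proof.
set D := (d _ _)%:R.
have up : (point_dist p q <= (pos p + pos q + D)%:E)%E.
  apply: ereal_inf_lbound; left; left; exists (src p, pos p); first by left.
  by exists (src q, pos q); [left|rewrite /= d_dist].
have pq1 : pos p <= 1 /\ pos q <= 1.
  by have /andP[_ ->] := graph_point_pos p; have /andP[_ ->] := graph_point_pos q.
have low : ((D - 2)%:E <= point_dist p q)%E.
  apply: le_ereal_inf_tmp => l [[[a pa [b qb <-]]|[]]|[]].
  - have [a0 da] := graph_point_end pa; have [b0 db] := graph_point_end qb.
    rewrite d_dist -EFinD lee_fin.
    have : (d (src p) (src q) <= d a.1 b.1 + 2)%N.
      have := graph_dist_triangle (src p) a.1 (src q); have := graph_dist_triangle a.1 b.1 (src q).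
      by rewrite (graph_dist_sym b.1); lia.
    by rewrite -(ler_nat R) natrD -/D; lra.
  - move=> + _ ->; rewrite lee_fin => pq; rewrite /D pq.
    have : (d (src q) (src q) <= 0)%N by apply: graph_dist_min; exact: walk0.
    by rewrite leqn0 => /eqP ->; have := normr_ge0 (pos p - pos q); lra.
  - move=> pq _ ->; rewrite lee_fin.
    have /= [_] := @graph_point_end q (tgt q, 1 - pos q) (or_intror erefl).
    rewrite graph_dist_sym -pq -(ler_nat R) -/D.
    by have := normr_ge0 (pos p - (1 - pos q)); lra.
have fin : point_dist p q \is a fin_num.
  by rewrite fin_numElt (lt_le_trans (ltNyr _) low) (le_lt_trans up (ltry _)).
rewrite -(fineK fin) !lee_fin in up low.
by rewrite ler_norml; apply/andP; split; lra.
Qed.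

Lemma hyperbolic_graphE :
  hyperbolic_graph R E <-> gromov_hyperbolic (fun u v => (d u v)%:R : R).
Proof.
apply: (@gromov_hyperbolic_perturb _ _ _ (@src R V E)) point_dist_src => v.
have e0 : 0 <= (0 : R) <= 1 by rewrite lexx ler01.
by exists (@GraphPoint R V E v v 0 (or_intror (conj erefl erefl)) e0).
Qed.

End GraphDistance.

Lemma sphere_hausdorff (R : realType) (X : topologicalType) (h : X -> 'rV[R]_3) :
  homeo_on setT (usphere 3) h -> hausdorff_space X.
Proof.
move=> [[_ hI _] cw _] p q pq; have ch := (continuous_subspace_setT h).2 cw.
apply: hI; rewrite ?inE //; apply: (@norm_hausdorff R 'rV[R]_3).
move=> A B /ch pA /ch qB; have [x [Ax Bx]] := pq _ _ pA qB.
by exists (h x).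
Qed.

(** * The fat path subdivision graph *)
Section FatPathGraph.
Variables (R : realType) (X : topologicalType) (h : X -> 'rV[R]_3).
Hypothesis hh : homeo_on setT (usphere 3) h.
Variable (Rl : subdivision_rule R X).
Hypothesis fB : branched_covering h (subdivision_map Rl).
Variable B : nat -> set (set X).
Hypothesis B_tiles : tiles B = [set setT].

Local Notation C k := (subdivision Rl k).
Local Notation vertex := (fat_vertex Rl B).

Let hX : hausdorff_space X := sphere_hausdorff hh.

Lemma vertex_eq (u v : vertex) : level u = level v -> tile u = tile v -> u = v.
Proof.
by move=> lv tv; apply: val_inj; rewrite [LHS]surjective_pairing [RHS]surjective_pairing;
  congr (_, _).
Qed.

Lemma vertexP (k : int) (t : set X) : tiles (level_complex Rl B k) t ->
  exists v : vertex, level v = k /\ tile v = t.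
Proof.
move=> kt; have kt' : fat_vertices Rl B (k, t) by [].
by exists (SigSub (mem_set kt')).
Qed.

Lemma vertex_cell k (v : vertex) : level v = Posz k ->
  exists2 d, C k 2 d & tile v = closure d.
Proof.
move=> lv; have := valP v; rewrite inE /fat_vertices /= -/(level v) lv.
by case=> d d2 dv; exists d.
Qed.

Lemma level_ge (v : vertex) : -1 <= level v.
Proof.
have := valP v; rewrite inE /fat_vertices /= -/(level v).
by case: (level v) => [//|[|n]] // [].
Qed.

Lemma root_tile (v : vertex) : level v = -1 -> tile v = setT.
Proof.
move=> lv; have := valP v; rewrite inE /fat_vertices /= -/(level v) lv.
by rewrite /= B_tiles.
Qed.

Lemma root_exists : exists v : vertex, level v = -1 /\ tile v = setT.
Proof. by apply: vertexP; rewrite /= B_tiles. Qed.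

(** The closure of c' is made of c' and of cells of smaller dimension, none of
    which meets c if c and c' are different. *)
Lemma tile_determined k c c' (A : set X) : C k 2 c -> C k 2 c' ->
  A !=set0 -> A `<=` c -> A `<=` closure c' -> c = c'.
Proof.
move=> c2 c'2 [x Ax] /(_ _ Ax) cx /(_ _ Ax) /(subdivision_closure hX c'2)[c'x|].
  by have [_ ->] := subdivision_unique c2 c'2 cx c'x.
move=> [m [e [m2 me ex]]].
by have [m2' _] := subdivision_unique me c2 ex cx; rewrite m2' in m2.
Qed.

Lemma two_cell_ancestor m j d : C (m + j) 2 d -> exists2 c, C m 2 c & d `<=` c.
Proof.
elim: j d => [|j IH] d; first by rewrite addn0 => d2; exists d.
rewrite addnS => /two_cell_parent[d' /IH[c c2 d'c] dd'].
by exists c => //; exact: subset_trans dd' d'c.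
Qed.

Lemma ancestor_unique (m : int) (u u' v : vertex) :
  level u = m -> level u' = m -> m <= level v ->
  tile v `<=` tile u -> tile v `<=` tile u' -> u = u'.
Proof.
move=> um u'm; have := level_ge u; rewrite um.
case: m um u'm => [m|[|//]] um u'm _ mv vu vu'; last first.
  by apply: vertex_eq; rewrite ?um // !root_tile.
have [k kv mk] : exists2 k, level v = Posz k & (m <= k)%N.
  by case: (level v) mv => [k mk|//]; exists k.
have [d] := vertex_cell kv; rewrite -(subnKC mk) => d2 vd.
have [c c2 dc] := two_cell_ancestor d2.
have [a a2 ua] := vertex_cell um; have [a' a'2 ua'] := vertex_cell u'm.
have d0 := subdivision_nonempty d2.
have da : d `<=` closure a by rewrite -ua; apply: subset_trans vu; rewrite vd; exact: subset_closure.
have da' : d `<=` closure a' by rewrite -ua'; apply: subset_trans vu'; rewrite vd; exact: subset_closure.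
apply: vertex_eq; rewrite ?um // ua ua'.
by rewrite -(tile_determined c2 a2 d0 dc da) -(tile_determined c2 a'2 d0 dc da').
Qed.

(** Levels start at -1. *)
Definition depth (v : vertex) : nat := absz (level v + 1).
(** At level -1 there is no tile of the previous level, and the default value of
    transition makes the root its own parent. *)
Definition parent (v : vertex) : vertex := transition (level v - 1) v.

Lemma depthE v : (depth v)%:Z = level v + 1.
Proof. by have := level_ge v; rewrite /depth; lia. Qed.

Lemma parentP v : level v != -1 ->
  level (parent v) = level v - 1 /\ tile v `<=` tile (parent v).
Proof.
move=> v0; rewrite /parent /transition.
have [u uP] : exists u : vertex, level u = level v - 1 /\ tile v `<=` tile u.
  have := level_ge v; case E: (level v) v0 => [[|k]|[|//]] // _ _.
    by have [r [r1 rT]] := root_exists; exists r; split; [rewrite r1|rewrite rT].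
  have [d /two_cell_parent[d' d'2 dd'] vd] := vertex_cell E.
  have [u [uk ud']] : exists u : vertex, level u = Posz k /\ tile u = closure d'.
    by apply: vertexP; exists d'.
  exists u; split; first by rewrite uk; lia.
  by rewrite ud' vd; exact: closureS.
by case: xgetP => [w -> //|/(_ u)].
Qed.

Lemma parent_root v : level v = -1 -> parent v = v.
Proof.
move=> v0; rewrite /parent /transition; case: xgetP => // w _ [wl _].
by have := level_ge w; rewrite wl v0.
Qed.

Lemma depth_parent v : depth (parent v) = (depth v).-1.
Proof.
have [v0|v0] := eqVneq (level v) (-1).
  by rewrite parent_root // /depth v0.
have [l _] := parentP v0.
by rewrite /depth l; have := level_ge v; lia.
Qed.

Lemma tile_parent v : tile v `<=` tile (parent v).
Proof. by have [/parent_root ->|/parentP[]] := eqVneq (level v) (-1). Qed.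

Lemma depth0_unique u v : depth u = 0%N -> depth v = 0%N -> u = v.
Proof.
move=> u0 v0; have := depthE u; have := depthE v; rewrite u0 v0 => v1 u1.
have {}u1 : level u = -1 by lia.
have {}v1 : level v = -1 by lia.
by apply: vertex_eq; rewrite ?root_tile // u1.
Qed.

(** Both sides are tiles of the same level that contain the tile of v. *)
Lemma transition_iter (j : nat) (v : vertex) : (j <= depth v)%N ->
  transition (level v - j%:Z) v = iter j parent v.
Proof.
move=> jv; set u := iter j parent v.
have vu : tile v `<=` tile u.
  rewrite /u; elim: j {jv u} => [//|j IH]; exact: subset_trans IH (@tile_parent _).
have lu : level u = level v - j%:Z.
  have := lev_up depth_parent j v; rewrite -/u => du.
  by have := depthE u; have := depthE v; rewrite du; lia.
rewrite /transition; case: xgetP => [w _ [wl vw]|/(_ u)]; last by case.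
by apply: ancestor_unique wl lu _ vw vu; lia.
Qed.

Local Notation H := (@horizontal R X Rl B).

Lemma horizontal_sym (u v : vertex) : H u v -> H v u.
Proof.
move=> [uv tuv [e e1 euv]]; split=> //; first by move=> /esym.
by exists e; [rewrite -uv|rewrite setIC].
Qed.

Lemma horizontal_depth (u v : vertex) : H u v -> depth u = depth v.
Proof. by case=> uv _ _; rewrite /depth uv. Qed.

(** The common edge of u and v lies in an open cell of the coarser level.  If this
    is a 2-cell, it is the interior of both parents.  If it is an edge, it meets
    the closures of both parents, so both contain it by edge_sub_closure. *)
Lemma horizontal_parent (u v : vertex) : H u v ->
  parent u = parent v \/ H (parent u) (parent v).
Proof.
move=> [uv tuv [e e1 euv]].
have [puv|puv] := pselect (parent u = parent v); [by left|right].
have [u0|u0] := eqVneq (level u) (-1).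
  by case: puv; rewrite !parent_root -?uv //; case: tuv; rewrite !root_tile // -uv.
have [lpu tpu] := parentP u0; have [lpv tpv] : level (parent v) = level v - 1 /\
  tile v `<=` tile (parent v) by apply: parentP; rewrite -uv.
have := level_ge (parent u); case E : (level (parent u)) => [k|[|//]] _; last first.
  by case: puv; apply: vertex_eq; rewrite ?root_tile //; lia.
have lu : level u = k.+1 by lia.
have E' : level (parent v) = k by lia.
rewrite lu in e1.
have [m [e' [me' ee']]] := subdivision_subdivides e1.
have [c c2 uc] := vertex_cell E; have [d d2 vd] := vertex_cell E'.
have [x ex] := subdivision_nonempty e1.
have [ux vx] : closure c x /\ closure d x.
  rewrite -uc -vd; have [ux vx] := euv _ (subset_closure ex).
  by split; [exact: tpu|exact: tpv].
have e'x := ee' _ ex; have cd : c <> d.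
  by move=> cd; apply: puv; apply: vertex_eq; [rewrite E E'|rewrite uc vd cd].
have same a : C k 2 a -> closure a x -> m = 2 -> a = e'.
  move=> a2 /(subdivision_closure hX a2)[ax|[n [e2 [n2 ne2 e2x]]]] m2.
    by have [_] := subdivision_unique a2 me' ax e'x.
  by have [nm _] := subdivision_unique ne2 me' e2x e'x; rewrite nm m2 in n2.
have m2 := subdivision_dim me'.
case: m => [|[|[|//]]] in me' m2 same.
- by case: (one_cell_infinite e1); exact: sub_finite_set ee' (zero_cell_finite me').
- split; [by rewrite E E'|by move=> tt; apply: puv; apply: vertex_eq => //; rewrite E E'|].
  exists e'; first by rewrite E.
  rewrite uc vd => z e'z; split; apply: closure_sub_closure e'z.
    exact: (edge_sub_closure hX fB c2 me' ux e'x).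
  exact: (edge_sub_closure hX fB d2 me' vx e'x).
- by case: cd; rewrite (same _ c2 ux) ?(same _ d2 vx).
Qed.

Lemma fat_edgeE (u v : vertex) : fat_edge u v <->
  [\/ u = parent v /\ depth v = (depth u).+1,
      v = parent u /\ depth u = (depth v).+1 | H u v].
Proof.
have vert (a b : vertex) : vertical a b <-> a = parent b /\ depth b = (depth a).+1.
  split=> [[ba tba]|[-> dba]].
    have b0 : level b != -1 by have := level_ge a; lia.
    have [lp tp] := parentP b0.
    split; last by have := depthE a; have := depthE b; lia.
    by apply: (@ancestor_unique (level a) _ _ b) => //; lia.
  split; last exact: tile_parent.
  by have := depthE (parent b); have := depthE b; lia.
by split=> -[/vert ?|/vert ?|?]; [constructor 1|constructor 2|constructor 3|
  constructor 1|constructor 2|constructor 3].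
Qed.

Lemma fat_edge_horizontal (k : int) (u v : vertex) : level u = k ->
  forall n, walk H n u v <->
  walk (fun u v => [/\ level u = k, level v = k & fat_edge u v]) n u v.
Proof.
move=> uk n; split.
  move=> W; elim: W uk => {n u v} [u|n u v w uv _ IH] uk; first exact: walk0.
  have vk : level v = k by case: (uv) => <-.
  by apply: walkS (IH vk); split=> //; constructor 3.
apply: walk_sub => a b [ak bk [[l _]|[l _]|//]]; lia.
Qed.

Lemma level_connected (u v : vertex) : level u = level v -> exists n, walk H n u v.
Proof.
move=> uv; have := level_ge u; case E : (level u) => [k|[|//]] _; last first.
  exists 0%N; rewrite (@vertex_eq u v) //; first exact: walk0.
  by rewrite !root_tile // -uv.
have [c c2 uc] := vertex_cell E.
have [d d2 vd] : exists2 d, C k 2 d & tile v = closure d.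
  by apply: vertex_cell; rewrite -uv.
have [n W] := tile_graph_connected hh hX fB c2 d2; exists n.
have vk : level v = Posz k by rewrite -uv.
clear uv; elim: W u v E vk uc vd => {n c d c2 d2} [c|n a b c ab _ IH] u v uk vk ua vb.
  by rewrite (@vertex_eq u v) ?uk ?ua //; exact: walk0.
have [a2 b2 nab [e e1 eab]] := ab.
have [w [wk wb]] : exists w : vertex, level w = Posz k /\ tile w = closure b.
  by apply: vertexP; exists b.
apply: walkS (IH w v wk vk wb vb); split; [by rewrite uk wk| |].
  rewrite ua wb => cab; apply: nab.
  apply: (tile_determined a2 b2 (subdivision_nonempty a2)) => //.
  by rewrite -cab; exact: subset_closure.
by exists e; rewrite ?uk // ua wb.
Qed.

Lemma near_le_level_dist (k : int) (u v : vertex) (L : nat) : level u = k ->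
  (level_dist k u v <= L%:R%:E)%E <-> near_by H L u v.
Proof.
move=> uk; rewrite /level_dist -(graph_dist_iff _ (fat_edge_horizontal v uk)).
exact: graph_dist_le.
Qed.

Lemma level_dist_nat (k : int) (u v : vertex) : level u = k -> level v = k ->
  exists n : nat, level_dist k u v = n%:R%:E.
Proof.
move=> uk vk; have [|n dn _] := @graph_dist_nat R _ H u v.
  by apply: level_connected; rewrite uk vk.
by exists n; rewrite -dn /level_dist -(graph_dist_iff _ (fat_edge_horizontal v uk)).
Qed.

End FatPathGraph.

Theorem theorem7p1 (R : realType) (X : topologicalType) (h : X -> 'rV[R]_3)
    (h_homeo : homeo_on setT (usphere 3) h)
    (Rl : subdivision_rule R X)
    (f_thurston : thurston_map h (subdivision_map Rl))
    (B : nat -> set (set X)) (B_base : base_structure h Rl B) :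
  hyperbolic_graph R (@fat_edge R X Rl B) <->
  exists M n : nat, [/\ (0 < M)%N, (0 < n)%N &
    forall (m : nat) (u v u' v' : fat_vertex Rl B),
      level u = m%:Z -> level v = m%:Z ->
      (M%:R%:E <= level_dist m%:Z u v)%E ->
      level u' = (m + n)%N%:Z -> level v' = (m + n)%N%:Z ->
      transition m%:Z u' = u -> transition m%:Z v' = v ->
      (level_dist m%:Z u v < level_dist (m + n)%N%:Z u' v')%E].
Proof.
have hX := sphere_hausdorff h_homeo.
have [fB _] := f_thurston; have [[_ B_tiles] _ _ _ _] := B_base.
have lev_par := depth_parent (Rl := Rl) B_tiles.
have root_unique := depth0_unique (Rl := Rl) B_tiles.
have H_lev := @horizontal_depth R X Rl B.
have H_sym := @horizontal_sym R X Rl B.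
have H_par := horizontal_parent h_homeo fB B_tiles.
have E_P := fat_edgeE (Rl := Rl) h_homeo B_tiles.
have [r [r1 _]] := root_exists Rl B_tiles.
have r0 : depth r = 0%N by rewrite /depth r1.
have E_sym := edge_sym H_sym E_P.
have conn (u v : fat_vertex Rl B) : exists n, walk (@fat_edge R X Rl B) n u v.
  have near0 : near_by (@horizontal R X Rl B) 0 (iter (depth u) (@parent R X Rl B) u)
      (iter (depth v) (@parent R X Rl B) v).
    by apply: (near_root _ root_unique); rewrite (lev_up lev_par) subnn.
  have [n _ W] := walk_via lev_par H_sym E_P (leqnn _) (leqnn _) near0.
  by exists n.
pose d u v := s2val (graph_dist_nat R (conn u v)).
have d_dist u v : graph_dist R (@fat_edge R X Rl B) u v = (d u v)%:R%:E.
  by rewrite /d; case: graph_dist_nat.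
have d_walk u v : walk (@fat_edge R X Rl B) (d u v) u v.
  by rewrite /d; case: graph_dist_nat.
have dm := graph_dist_min d_dist.
(* Expansion from level m to level m + n says the same as contraction from depth
   m + n + 1 to depth m + 1. *)
rewrite (hyperbolic_graphE E_sym d_dist d_walk); split.
- move=> /(hyperbolic_contracting lev_par root_unique H_lev H_sym H_par E_P d_walk
    (fun n u v => @dm n u v) r0)[M [n [M0 n0 contr]]].
  exists M, n; split=> // m u v u' v' um vm Muv u'm v'm u'u v'v.
  have up (w w' : fat_vertex Rl B) : level w' = (m + n)%N%:Z ->
      transition m%:Z w' = w -> iter n (@parent R X Rl B) w' = w.
    move=> w'm <-; rewrite -(transition_iter h_homeo B_tiles); last by have := depthE w'; lia.
    by congr transition; rewrite w'm; lia.
  have [a da] := level_dist_nat h_homeo fB B_tiles um vm.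
  have [b db] := level_dist_nat h_homeo fB B_tiles u'm v'm.
  rewrite da db lte_fin ltr_nat ltnNge; apply/negP => ba.
  rewrite da lee_fin ler_nat in Muv.
  have near_b : near_by (@horizontal R X Rl B) b u' v'.
    by apply/(near_le_level_dist _ _ u'm); rewrite db.
  have a_le L : near_by (@horizontal R X Rl B) L u v -> (a <= L)%N.
    by move=> /(near_le_level_dist v L um); rewrite da lee_fin ler_nat.
  have [bM|Mb] := leqP b M.
    have := contr _ _ (near_le bM near_b); rewrite (up u u') // (up v v') // => /a_le.
    lia.
  (* a shortest walk from u' to v' has a first piece of length M, which contracts *)
  rewrite -(subnKC (ltnW Mb)) in near_b.
  have [w /contr uw wv] := near_split near_b.
  have := near_trans uw (near_up H_par n wv).
  by rewrite (up u u') // (up v v') // => /a_le; lia.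
- move=> [M [n [M0 n0 expand]]].
  apply: (contracting_hyperbolic lev_par root_unique H_lev H_sym H_par E_P d_walk
    (fun n u v => @dm n u v) M0 (n := n)) => u v uv.
  have uv_lev := near_lev H_lev uv.
  (* climbing n levels from u and v leads to the root *)
  have [un|un] := leqP (depth u) n.
    by apply: (near_root _ root_unique); rewrite (lev_up lev_par); lia.
  pose m := (depth u - n.+1)%N.
  have um : level u = (m + n)%N%:Z by have := depthE u; rewrite /m; lia.
  have vm : level v = (m + n)%N%:Z by have := depthE v; rewrite /m; lia.
  have tr (w : fat_vertex Rl B) : level w = (m + n)%N%:Z ->
      transition m%:Z w = iter n (@parent R X Rl B) w.
    move=> wm; rewrite -(transition_iter h_homeo B_tiles); last by have := depthE w; lia.
    by congr transition; rewrite wm; lia.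
  have lt (w : fat_vertex Rl B) : level w = (m + n)%N%:Z ->
      level (iter n (@parent R X Rl B) w) = m%:Z.
    move=> wm; have := depthE w; have := depthE (iter n (@parent R X Rl B) w).
    by rewrite (lev_up lev_par) wm; lia.
  apply/(near_le_level_dist _ _ (lt _ um)).
  have [a da] := level_dist_nat h_homeo fB B_tiles (lt _ um) (lt _ vm).
  rewrite da lee_fin ler_nat; have [aM|Ma] := ltnP a M; first lia.
  have := expand m _ _ u v (lt _ um) (lt _ vm) _ um vm (tr _ um) (tr _ vm).
  rewrite da lee_fin ler_nat => /(_ Ma).
  have /(near_le_level_dist v M um) := uv => le /lt_le_trans/(_ le).
  by rewrite lte_fin ltr_nat; lia.
Qed.
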